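(* Let $1\le q<p\le\infty$, $\alpha\in[0,\infty)$, and let $\mathcal{X}$ be either $\mathbb{R}^n$ or a cube $Q_0$ of $\mathbb{R}^n$. Then $f\in\widetilde{JN}_{(p,q,0)_\alpha}(\mathcal{X})$ if and only if $f\in L^q_{\mathrm{loc}}(\mathcal{X})$ and $$\mathrm{A}(f):=\sup\left\{\sum_i|Q_i|\left[|Q_i|^{-\alpha}\left\{\frac1{|Q_i|}\int_{Q_i}|f-\mathcal{M}_{Q_i}(f)|^q\right\}^{1/q}\right]^p\right\}^{1/p}<\infty,$$ where the supremum is taken over all collections $\{Q_i\}_i$ of cubes contained in $\mathcal{X}$ with pairwise disjoint interiors. Moreover, there exist positive constants $c_1,c_2$ such that $c_1\,\mathrm{A}(f)\le\|f\|_{\widetilde{JN}_{(p,q,0)_\alpha}(\mathcal{X})}\le c_2\,\mathrm{A}(f)$ for every $f\in L^q_{\mathrm{loc}}(\mathcal{X})$ ($c_1,c_2$ are independent of $f$).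
   Context: A cube in $\mathbb{R}^n$ has finite positive edge length and edges parallel to the coordinate axes; it need not be open or closed. $\mathcal{X}$ denotes either $\mathbb{R}^n$ or a fixed cube $Q_0$ of $\mathbb{R}^n$. Functions are real-valued. $L^q_{\mathrm{loc}}(\mathcal{X})$ is the set of measurable $f$ on $\mathcal{X}$ with $f\mathbf 1_E\in L^q(\mathcal{X})$ for every bounded $E\subset\mathcal{X}$. Write $|f|_Q:=\frac1{|Q|}\int_Q|f|$. For a cube $Q$ and $x\in Q$, $\mathcal{M}_Q(f)(x):=\sup\frac1{|Q_*|}\int_{Q_*}|f(y)|\,dy$, the supremum being over all cubes $Q_*$ with $x\in Q_*\subset Q$. For $f\in L^q_{\mathrm{loc}}(\mathcal{X})$ define, for $p\in[1,\infty)$, $$\|f\|_{\widetilde{JN}_{(p,q,0)_\alpha}(\mathcal{X})}:=\sup\left\{\sum_i|Q_i|\left[|Q_i|^{-\alpha}\left\{\frac1{|Q_i|}\int_{Q_i}\big|f-|f|_{Q_i}\big|^q\right\}^{1/q}\right]^p\right\}^{1/p},$$ the supremum being over all collections $\{Q_i\}_i$ of cubes contained in $\mathcal{X}$ with pairwise disjoint interiors, and for $p=\infty$, $$\|f\|_{\widetilde{JN}_{(\infty,q,0)_\alpha}(\mathcal{X})}:=\sup_{Q\subset\mathcal{X}}|Q|^{-\alpha}\left\{\frac1{|Q|}\int_Q\big|f-|f|_Q\big|^q\right\}^{1/q}.$$ $\widetilde{JN}_{(p,q,0)_\alpha}(\mathcal{X})$ is the set of $f\in L^q_{\mathrm{loc}}(\mathcal{X})$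 for which this quantity is finite. Likewise, when $p=\infty$, $\mathrm{A}(f)$ is understood as $\sup_{Q\subset\mathcal{X}}|Q|^{-\alpha}\{\frac1{|Q|}\int_Q|f-\mathcal{M}_Q(f)|^q\}^{1/q}$, the supremum over all cubes $Q\subset\mathcal{X}$. *)

(* Defs.v *)
From HB Require Import structures.
From mathcomp Require Import all_boot all_order all_algebra.
From mathcomp Require Import all_classical all_reals all_analysis.

Set Implicit Arguments.
Unset Strict Implicit.
Unset Printing Implicit Defensive.

Import Order.TTheory GRing.Theory Num.Theory.
Import numFieldNormedType.Exports.

Local Open Scope classical_set_scope.
Local Open Scope ring_scope.
Local Open Scope ereal_scope.

(* MathComp-Analysis has Lebesgue measure on R only.  On R^n = 'rV[R]_n we take
   the n-fold product of it on the product sigma-algebra (which is the Borel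
   one), and then complete it with the library's Caratheodory extension. *)

Definition rV_display : measure_display. Proof. exact: default_measure_display. Qed.

Definition rV_coord (R : realType) (n : nat) (i : 'I_n) (x : 'rV[R]_n) :
  measurableTypeR R := x ord0 i.

Section measurable_rV.
Context (R : realType) (n : nat).

Let coors := @rV_coord R n.

Let rV_set0 : g_sigma_preimage coors set0.
Proof. exact: sigma_algebra0. Qed.

Let rV_setC A : g_sigma_preimage coors A -> g_sigma_preimage coors (~` A).
Proof. exact: sigma_algebraC. Qed.

Let rV_bigcup (F : _^nat) : (forall i, g_sigma_preimage coors (F i)) ->
  g_sigma_preimage coors (\bigcup_i (F i)).
Proof. exact: sigma_algebra_bigcup. Qed.

HB.instance Definition _ := @isMeasurable.Build rV_display
  'rV[R]_n (g_sigma_preimage coors) rV_set0 rV_setC rV_bigcup.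

End measurable_rV.


Lemma measurable_rV_coord (R : realType) (n : nat) (i : 'I_n) :
  measurable_fun [set: 'rV[R]_n] (@rV_coord R n i).
Proof.
move=> _ Y mY; rewrite setTI; apply: sub_sigma_algebra => /=.
rewrite -bigcup_seq/=; exists i => /=; first by rewrite mem_index_enum.
by exists Y => //; rewrite setTI.
Qed.

Lemma measurable_fun_rVP d (T : measurableType d) (R : realType) (n : nat)
    (f : T -> 'rV[R]_n) :
  (forall i, measurable_fun [set: T] (@rV_coord R n i \o f)) ->
  measurable_fun [set: T] f.
Proof.
move=> mf.
suff : preimage_set_system [set: T] f measurable `<=` measurable.
  by move=> h _ A mA; apply: h; exists A.
have -> : preimage_set_system [set: T] f measurable =
    g_sigma_preimage (fun i => @rV_coord R n i \o f).
  exact/esym/(@g_sigma_preimage_comp _ (measurableTypeR R) n 'rV[R]_n).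
apply: smallest_sub; first exact: sigma_algebra_measurable.
move=> A; rewrite -bigcup_seq => -[i _ [B mB <-]].
exact: mf.
Qed.

Definition rV_cons (R : realType) (n : nat) (x : measurableTypeR R * 'rV[R]_n) :
  'rV[R]_n.+1 := @row_mx R 1 1 n (const_mx x.1) x.2.

Definition rV_uncons (R : realType) (n : nat) (x : 'rV[R]_n.+1) :
  measurableTypeR R * 'rV[R]_n := (x ord0 ord0, @rsubmx R 1 1 n x).

Lemma rV_cons0 (R : realType) (n : nat) a (x : 'rV[R]_n) :
  rV_cons (a, x) ord0 ord0 = a.
Proof.
have -> : (ord0 : 'I_n.+1) = lshift n (ord0 : 'I_1) by exact/val_inj.
by apply: etrans (row_mxEl _ _ _ _) _; rewrite mxE.
Qed.

Lemma rV_consK (R : realType) (n : nat) : cancel (@rV_cons R n) (@rV_uncons R n).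
Proof.
move=> [a x]; rewrite /rV_uncons /rV_cons row_mxKr; congr pair.
exact: rV_cons0.
Qed.

Lemma rV_consS (R : realType) (n : nat) a (x : 'rV[R]_n) (i : 'I_n) :
  rV_cons (a, x) ord0 (lift ord0 i) = x ord0 i.
Proof.
have -> : lift ord0 i = rshift 1 i by exact/val_inj.
exact: row_mxEr.
Qed.

Lemma measurable_rV_cons (R : realType) (n : nat) :
  measurable_fun [set: measurableTypeR R * 'rV[R]_n] (@rV_cons R n).
Proof.
apply: measurable_fun_rVP => i; case: (unliftP ord0 i) => [j|] ->.
  rewrite (_ : _ \o _ = @rV_coord R n j \o snd).
    by apply: measurableT_comp => //; exact: measurable_rV_coord.
  by apply/funext => -[a x]; exact: rV_consS.
rewrite (_ : _ \o _ = fst) //.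
by apply/funext => -[a x]; exact: rV_cons0.
Qed.

Lemma measurable_rV_uncons (R : realType) (n : nat) :
  measurable_fun [set: 'rV[R]_n.+1] (@rV_uncons R n).
Proof.
apply: measurable_fun_pair; first exact: (@measurable_rV_coord R n.+1 ord0).
apply: measurable_fun_rVP => i.
rewrite (_ : _ \o _ = @rV_coord R n.+1 (lift ord0 i)).
  exact: measurable_rV_coord.
apply/funext => x; rewrite /rV_coord /= mxE; congr (x _ _).
exact/val_inj.
Qed.

Lemma product_measure1_sigma_finite d1 d2 (T1 : measurableType d1) (T2 : measurableType d2) (R : realType)
    (m1 : {sigma_finite_measure set T1 -> \bar R})
    (m2 : {sigma_finite_measure set T2 -> \bar R}) :
  sigma_finite setT (m1 \x m2).
Proof.
have /sigma_finiteP[F [TF ndF Foo]] := sigma_finiteT m1.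
have /sigma_finiteP[G [TG ndG Goo]] := sigma_finiteT m2.
exists (fun n => F n `*` G n).
 rewrite -setXTT TF TG predeqE => -[x y]; split.
    move=> [/= [n _ Fnx] [k _ Gky]]; exists (maxn n k) => //; split.
    - by move: x Fnx; exact/subsetPset/ndF/leq_maxl.
    - by move: y Gky; exact/subsetPset/ndG/leq_maxr.
  by move=> [n _ []/= ? ?]; split; exists n.
move=> k; have [? ?] := Foo k; have [? ?] := Goo k.
split; first exact: measurableX.
by rewrite product_measure1E// lte_mul_pinfty// ge0_fin_numE.
Qed.

Section borel_measure_step.
Context (R : realType) (n : nat).
Variable m : {sigma_finite_measure set 'rV[R]_n -> \bar R}.

Definition borel_measure_step : set 'rV[R]_n.+1 -> \bar R :=
  pushforward (@lebesgue_measure R \x m) (@rV_cons R n).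

Let step0 : borel_measure_step set0 = 0.
Proof. by rewrite /borel_measure_step /pushforward preimage_set0 measure0. Qed.

Let step_ge0 A : 0 <= borel_measure_step A.
Proof. by rewrite /borel_measure_step /pushforward. Qed.

Let step_sigma_additive : semi_sigma_additive borel_measure_step.
Proof.
have mf := @measurable_rV_cons R n.
move=> F mF tF mUF; rewrite /borel_measure_step /pushforward preimage_bigcup.
apply: measure_semi_sigma_additive.
- by move=> k; rewrite -[X in measurable X]setTI; exact: mf.
- apply/trivIsetP => /= i j _ _ ij; rewrite -preimage_setI.
  by move/trivIsetP : tF => /(_ _ _ _ _ ij) ->//; rewrite preimage_set0.
- by rewrite -preimage_bigcup -[X in measurable X]setTI; exact: mf.
Qed.

HB.instance Definition _ := isMeasure.Build _ _ _ borel_measure_step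
  step0 step_ge0 step_sigma_additive.

Let step_sigma_finite : sigma_finite setT borel_measure_step.
Proof.
have [F FT mF] : sigma_finite setT (@lebesgue_measure R \x m).
  exact: product_measure1_sigma_finite.
exists (fun k => @rV_uncons R n @^-1` F k).
  by rewrite -preimage_bigcup -FT preimage_setT.
move=> k; have [mFk Fkoo] := mF k; split.
  by rewrite -[X in measurable X]setTI; exact: measurable_rV_uncons.
rewrite /borel_measure_step /pushforward -comp_preimage.
by rewrite (_ : _ \o _ = id) //; apply/funext => x; exact: rV_consK.
Qed.

HB.instance Definition _ := Measure_isSigmaFinite.Build _ _ _ borel_measure_step
  step_sigma_finite.

End borel_measure_step.

Fixpoint borel_lebesgue (R : realType) (n : nat) :
    {sigma_finite_measure set 'rV[R]_n -> \bar R} :=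
  if n is k.+1 then borel_measure_step (borel_lebesgue R k)
  else \d_(0%R : 'rV[R]_0).

Lemma borel_lebesgue_setX (R : realType) (n : nat)
    (A : 'I_n -> set (measurableTypeR R)) : (forall i, measurable (A i)) ->
  borel_lebesgue R n [set x | forall i, A i (x ord0 i)] =
  \prod_(i < n) lebesgue_measure (A i).
Proof.
elim: n A => [|n IH] A mA.
  rewrite big_ord0 /= diracE mem_set //; by case.
have mA' : measurable [set x : 'rV[R]_n | forall i, A (lift ord0 i) (x ord0 i)].
  rewrite (_ : mkset _ =
      \bigcap_(i in [set: 'I_n]) (@rV_coord R n i @^-1` A (lift ord0 i))).
    apply: fin_bigcap_measurable => // i _.
    by rewrite -[X in measurable X]setTI; exact: measurable_rV_coord.
  by apply/seteqP; split => x Ax i; [move=> _|]; exact: Ax.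
rewrite big_ord_recl -IH // /= /borel_measure_step /pushforward.
rewrite -product_measure1E //; congr (_ _).
apply/seteqP; split => -[a x] /=.
  move=> Aax; split => [|i].
    by have := Aax ord0; rewrite rV_cons0.
  by have := Aax (lift ord0 i); rewrite rV_consS.
move=> [Aa Ax] i; case: (unliftP ord0 i) => [j|] ->.
  by rewrite rV_consS.
by rewrite rV_cons0.
Qed.

(* R^n with the sigma-algebra of its Lebesgue measurable sets. *)
Notation Rn R n := (caratheodory_type (mu_ext (borel_lebesgue R n))).

Definition leb (R : realType) (n : nat) : {measure set (Rn R n) -> \bar R} :=
  @completed_measure_extension _ _ _ (borel_lebesgue R n).

(* A cube is a product of n intervals with a common length l; b and c choose,
   separately for every coordinate, whether each endpoint is included. *)
Definition is_cube (R : realType) (n : nat) (Q : set 'rV[R]_n) : Prop :=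
  exists (a : 'rV[R]_n) (l : R) (b c : 'I_n -> bool),
    (0 < l)%R /\
    Q = [set x : 'rV[R]_n | forall i, x ord0 i \in
           Interval (BSide (b i) (a ord0 i)) (BSide (c i) (a ord0 i + l)%R)].

Lemma leb_cube (R : realType) (n : nat) (a : 'rV[R]_n) (l : R)
    (b c : 'I_n -> bool) : (0 < l)%R ->
  leb R n [set x : 'rV[R]_n | forall i, x ord0 i \in
           Interval (BSide (b i) (a ord0 i)) (BSide (c i) (a ord0 i + l)%R)] =
  (l ^+ n)%:E.
Proof.
move=> l0.
pose A i : set (measurableTypeR R) :=
  [set` Interval (BSide (b i) (a ord0 i)) (BSide (c i) (a ord0 i + l)%R)].
have mA i : measurable (A i) by exact: measurable_itv.
transitivity (borel_lebesgue R n [set x | forall i, A i (x ord0 i)]).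
  apply: measurable_mu_extE.
  rewrite (_ : mkset _ = \bigcap_(i in [set: 'I_n]) (@rV_coord R n i @^-1` A i)).
    apply: fin_bigcap_measurable => // i _.
    by rewrite -[X in measurable X]setTI; exact: measurable_rV_coord.
  by apply/seteqP; split => x Ax i; [move=> _|]; exact: Ax.
rewrite borel_lebesgue_setX // (eq_bigr (fun=> l%:E)) => [|i _].
  by rewrite prodEFin prodr_const card_ord.
rewrite /A lebesgue_measure_itv /= lte_fin ltrDl l0.
by rewrite -EFinD addrAC subrr add0r.
Qed.

Section spaces.
Context (R : realType) (n : nat).
Implicit Types (X Q : set 'rV[R]_n) (f : 'rV[R]_n -> R) (g : 'rV[R]_n -> \bar R)
  (p : \bar R) (q alpha : R).

Definition average Q g : \bar R :=
  (fine (leb R n Q))^-1%:E * \int[leb R n]_(x in Q) g x.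

(* The supremum may be +oo at some points even though f is real-valued. *)
Definition maximal Q f (x : 'rV[R]_n) : \bar R :=
  ereal_sup [set average P (fun y => `|f y|%:E) | P in
    [set P | [/\ is_cube P, P x & P `<=` Q]]].

(* f \_ E is the extension by 0 of the restriction of f to E. *)
Definition Lq_loc q X f : Prop :=
  measurable_fun (X : set (Rn R n)) f /\
  forall E : set (Rn R n), measurable E -> bounded_set (E : set 'rV[R]_n) ->
    E `<=` X -> \int[leb R n]_(x in X) (`|(f \_ E) x| `^ q)%:E < +oo.

(* |Q|^(-alpha) times the q-mean over Q of f - g *)
Definition weighted_osc q alpha Q f g : \bar R :=
  (fine (leb R n Q) `^ (- alpha))%:E *
  (average Q (fun x => `|(f x)%:E - g x| `^ q)) `^ q^-1.

Definition packing X (C : set (set 'rV[R]_n)) : Prop :=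
  [/\ forall Q, C Q -> is_cube Q, forall Q, C Q -> Q `<=` X &
      trivIset C (@interior 'rV[R]_n)].

(* The common shape of the seminorm of JN and of A: f is compared on every cube
   Q with h Q.  Only the values p >= 1 matter, the case p = -oo is a dummy. *)
Definition JN_sup p q alpha X f (h : set 'rV[R]_n -> 'rV[R]_n -> \bar R) :
    \bar R :=
  match p with
  | r%:E => ereal_sup
      [set (\esum_(Q in C) (leb R n Q * weighted_osc q alpha Q f (h Q) `^ r))
             `^ r^-1 | C in packing X]
  | +oo => ereal_sup
      [set weighted_osc q alpha Q f (h Q) | Q in
        [set Q | is_cube Q /\ Q `<=` X]]
  | -oo => 0
  end.

Definition JN_norm p q alpha X f : \bar R :=
  JN_sup p q alpha X f (fun Q _ => average Q (fun y => `|f y|%:E)).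

Definition JN_space p q alpha X : set ('rV[R]_n -> R) :=
  [set f | Lq_loc q X f /\ JN_norm p q alpha X f < +oo].

Definition A_norm p q alpha X f : \bar R :=
  JN_sup p q alpha X f (fun Q => maximal Q f).

End spaces.

(* Main.v *)
(* Write g = |f|, g_P for its mean over P and osc P for the mean of |g - g_P| over
   P. Both seminorms control osc: |g - g_P| <= |f - g_P|, and since g_P <= M_P f
   the negative part of g - g_P, whose integral is half that of |g - g_P|, is at
   most |f - M_P f|. By the triangle inequality it then suffices to bound the
   L^q mean over a cube Q of M_Q f - g_Q by sums of |P| (osc P)^p over packings of Q.

   For the dyadic maximal function this is a John-Nirenberg good-lambda
   inequality, proved by induction on the depth of the dyadic tree. The full
   maximal function exceeds the dyadic one by more than a given amount only on
   subcubes of large oscillation, whose union is controlled by the Vitali covering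
   lemma. This gives a weak L^p bound, hence an L^q bound because q < p.

   Whether M_Q f is measurable never matters, since it is only compared with a
   measurable majorant, and no differentiation theorem is used. *)
Require Import Defs.
From HB Require Import structures.
From mathcomp Require Import all_boot all_order all_algebra.
From mathcomp Require Import all_classical all_reals all_analysis.
From mathcomp Require Import measurable_realfun ring lra.

Import Order.TTheory GRing.Theory Num.Theory.
Import numFieldNormedType.Exports.
Local Open Scope classical_set_scope.
Local Open Scope ring_scope.
Local Open Scope ereal_scope.

Set Implicit Arguments.
Unset Strict Implicit.
Unset Printing Implicit Defensive.

(** * Cubes *)

Section cubes.
Local Open Scope ring_scope.
Context (R : realType) (n : nat).

(** The roles of |f|_Q and M_Q f are interchangeable: with either one called a [reference], a single
    transfer from any reference to any other yields both inequalities with one constant. The local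
    estimate on a cube Q sees the seminorm only through a set function [kappa], superadditive over
    disjoint cubes. For finite p it is a multiple of the packing supremum inside P; since packings
    of the members of a packing glue together, the local bounds can be summed again. For p = +oo it
    is a multiple of the volume. The weights enter only through |P|^alpha <= |Q|^alpha for P inside
    Q, where alpha >= 0 is used; the resulting factor |Q|^alpha cancels against the weight of Q.
    Dyadic selection is always cut off at a finite depth, with bounds independent of the depth, so
    that inductions and coverings stay finite and only increasing unions are taken in the limit. *)

Record cube := Cube {
  corner : 'rV[R]_n;
  side : R;
  lclosed : 'I_n -> bool;
  ropen : 'I_n -> bool;
  side_gt0 : 0 < side }.

Implicit Types (P Q D : cube) (x : 'rV[R]_n).

Definition cset Q : set 'rV[R]_n := [set x | forall i, x ord0 i \in
  Interval (BSide (lclosed Q i) (corner Q ord0 i))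
           (BSide (ropen Q i) (corner Q ord0 i + side Q))].

Definition vol Q : R := side Q ^+ n.

Lemma is_cubeP (A : set 'rV[R]_n) : is_cube A <-> exists Q, A = cset Q.
Proof.
split=> [[a [l [b [c [l0 ->]]]]]|[[a l b c l0] ->]].
  by exists (Cube a b c l0).
by exists a, l, b, c.
Qed.

Lemma is_cube_cset Q : is_cube (cset Q).
Proof. by apply/is_cubeP; exists Q. Qed.

Lemma vol_gt0 Q : 0 < vol Q.
Proof. by rewrite exprn_gt0 // side_gt0. Qed.

Lemma leb_cset Q : leb R n (cset Q) = (vol Q)%:E.
Proof. by rewrite /cset leb_cube // side_gt0. Qed.

Lemma measurable_cset Q : measurable (cset Q : set (Rn R n)).
Proof.
apply: sub_caratheodory; apply: sub_sigma_algebra.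
rewrite (_ : cset Q = \bigcap_(i in [set: 'I_n]) (@rV_coord R n i @^-1`
    [set` Interval (BSide (lclosed Q i) (corner Q ord0 i))
           (BSide (ropen Q i) (corner Q ord0 i + side Q))])).
  apply: fin_bigcap_measurable => // i _.
  by rewrite -[X in measurable X]setTI; exact: measurable_rV_coord.
by apply/seteqP; split => x Ax i; [move=> _|]; exact: Ax.
Qed.

Lemma in_side (b c : bool) (a u y : R) :
  y \in Interval (BSide b a) (BSide c u) =
  (a < y ?<= if b) && (y < u ?<= if ~~ c).
Proof. by rewrite in_itv. Qed.

Lemma cset_le Q x i : cset Q x ->
  corner Q ord0 i <= x ord0 i <= corner Q ord0 i + side Q.
Proof.
by move=> /(_ i); rewrite in_side => /andP[/lteifW -> /lteifW ->].
Qed.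

Lemma open_cset Q x :
  (forall i, corner Q ord0 i < x ord0 i < corner Q ord0 i + side Q) ->
  cset Q x.
Proof. by move=> h i; rewrite in_side; have /andP[? ?] := h i; rewrite !lteifS. Qed.

Definition center Q : 'rV[R]_n := \row_i (corner Q ord0 i + side Q / 2).

Lemma cset_center Q : cset Q (center Q).
Proof.
apply: open_cset => i; rewrite mxE; have := side_gt0 Q; lra.
Qed.

Lemma cset_neq0 Q : cset Q !=set0.
Proof. by exists (center Q); exact: cset_center. Qed.

Lemma interior_cset_center Q : interior (cset Q) (center Q).
Proof.
have l0 := side_gt0 Q.
apply/nbhs_ballP; exists (side Q / 2) => /=; first by rewrite divr_gt0.
move=> y yB; apply: open_cset => i.
have [_ /(_ ord0 i)] := yB; rewrite /center mxE /ball /= ltr_norml; lra.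
Qed.

(** Faces may be open, so the corners of P need not belong to P. The diagonal points [corner P + t]
    with 0 < t < [side P] always do, and a supposed overhang is refuted by taking t half an overhang
    (or half a side, if that is shorter) away from the offending face. *)
Lemma sub_cset_corner P Q : cset P `<=` cset Q ->
  forall i, corner Q ord0 i <= corner P ord0 i /\
    corner P ord0 i + side P <= corner Q ord0 i + side Q.
Proof.
move=> PQ i.
have P0 := side_gt0 P.
have key t : 0 < t < side P ->
    corner Q ord0 i <= corner P ord0 i + t <= corner Q ord0 i + side Q.
  move=> /andP[t0 t1].
  have := @cset_le Q (\row_j (corner P ord0 j + t)) i.
  rewrite !mxE; apply; apply: PQ; apply: open_cset => j; rewrite mxE; lra.
split; rewrite leNgt; apply/negP => h.
- have [?|?] := leP (side P) (corner Q ord0 i - corner P ord0 i).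
    by have /key/andP[? ?] : 0 < side P / 2 < side P; lra.
  by have /key/andP[? ?] :
    0 < (corner Q ord0 i - corner P ord0 i) / 2 < side P; lra.
- have [?|?] := leP (side P)
      (corner P ord0 i + side P - (corner Q ord0 i + side Q)).
    by have /key/andP[? ?] : 0 < side P / 2 < side P; lra.
  by have /key/andP[? ?] : 0 < side P -
    (corner P ord0 i + side P - (corner Q ord0 i + side Q)) / 2 < side P; lra.
Qed.

Lemma sub_cset_side P Q : (0 < n)%N -> cset P `<=` cset Q -> side P <= side Q.
Proof. by move=> n0 /sub_cset_corner /(_ (Ordinal n0)) []; lra. Qed.

Lemma half_side_gt0 Q : 0 < side Q / 2.
Proof. by rewrite divr_gt0 // side_gt0. Qed.

(* Endpoints on the boundary of Q keep their type, interior ones are closed on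
   the left and open on the right: the children partition Q exactly. *)
Definition child Q (e : {ffun 'I_n -> bool}) : cube :=
  Cube (\row_i (corner Q ord0 i + if e i then side Q / 2 else 0))
    (fun i => e i || lclosed Q i) (fun i => ~~ e i || ropen Q i)
    (half_side_gt0 Q).

Lemma vol_child Q e : vol (child Q e) = vol Q / 2 ^+ n.
Proof. by rewrite /vol /= expr_div_n. Qed.

Lemma sub_child Q e : cset (child Q e) `<=` cset Q.
Proof.
move=> x /[swap] i /(_ i); rewrite !in_side /= mxE.
have Q0 := side_gt0 Q.
case: (e i) => /=.
  move=> /andP[h1]; rewrite -addrA -splitr => ->; rewrite andbT.
  by apply: lteifS; lra.
rewrite addr0 => /andP[-> /= h]; apply: lteifS; lra.
Qed.

Lemma cset_child Q x : cset Q x -> exists e, cset (child Q e) x.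
Proof.
move=> Qx; exists [ffun i => corner Q ord0 i + side Q / 2 <= x ord0 i] => i.
rewrite in_side /= mxE ffunE; have := Qx i; rewrite in_side.
case: leP => /= h /andP[h1 h2].
  by rewrite h -addrA -splitr h2.
by rewrite addr0 h1.
Qed.

Lemma trivIset_child Q : trivIset setT (fun e => cset (child Q e)).
Proof.
move=> e e' _ _ [x [xe xe']]; apply/ffunP => i.
move: (xe i) (xe' i); rewrite !in_side /= !mxE.
by case: (e i); case: (e' i) => //=; rewrite ?addr0 => /andP[+ +] /andP[]; lra.
Qed.

(* In each coordinate the sides of P and D meet and are at most [side D] long, so
   an interval of length [2 * side D] contains both; it is moved to the left when
   it would leave Q. *)
Lemma cube_hull P D Q x : cset P x -> cset D x ->
  cset P `<=` cset Q -> cset D `<=` cset Q ->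
  side P <= side D -> 2 * side D <= side Q ->
  exists H, [/\ cset P `<=` cset H, cset D `<=` cset H, cset H `<=` cset Q &
                side H = 2 * side D].
Proof.
move=> Px Dx PQ DQ PD DQ2.
have D0 := side_gt0 D.
have H0 : 0 < 2 * side D by lra.
pose a i := Num.min (Num.min (corner P ord0 i) (corner D ord0 i))
                    (corner Q ord0 i + side Q - 2 * side D).
(* Endpoints of H strictly inside Q are closed, so nothing of P or D is lost there; those on the
   boundary of Q copy the type of Q, which keeps H inside Q. *)
pose H := Cube (\row_i a i)
  (fun i => (corner Q ord0 i < a i) || lclosed Q i)
  (fun i => ~~ (a i + 2 * side D < corner Q ord0 i + side Q) && ropen Q i) H0.
have aP i : [/\ a i <= corner P ord0 i, a i <= corner D ord0 i,
    corner Q ord0 i <= a i & [/\ corner P ord0 i + side P <= a i + 2 * side D,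
    corner D ord0 i + side D <= a i + 2 * side D &
    a i + 2 * side D <= corner Q ord0 i + side Q]].
  have [? ?] := sub_cset_corner PQ i; have [? ?] := sub_cset_corner DQ i.
  have /andP[? ?] := cset_le i Px; have /andP[? ?] := cset_le i Dx.
  rewrite /a; case: (leP (corner P ord0 i)) => ?;
    by case: (leP _ (corner Q ord0 i + side Q - 2 * side D)) => ?;
      repeat split; lra.
have sub (P' : cube) : cset P' `<=` cset Q ->
    (forall i, a i <= corner P' ord0 i /\
       corner P' ord0 i + side P' <= a i + 2 * side D) -> cset P' `<=` cset H.
  move=> P'Q aP' y P'y i; have [h1 h2] := aP' i.
  have := P'Q _ P'y i; have /andP[h3 h4] := cset_le i P'y.
  rewrite !in_side /= !mxE => /andP[h5 h6]; apply/andP; split.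
    have [?|h7] := ltP (corner Q ord0 i) (a i) => /=; first by lra.
    have [_ _ h8 _] := aP i.
    by have -> : a i = corner Q ord0 i by lra.
  have [?|h7] := ltP (a i + 2 * side D) (corner Q ord0 i + side Q) => /=.
    by lra.
  have [_ _ _ [_ _ h8]] := aP i.
  by have -> : a i + 2 * side D = corner Q ord0 i + side Q by lra.
exists H; split => //.
- by apply: sub => // i; have [? ? ? []] := aP i.
- by apply: sub => // i; have [? ? ? []] := aP i.
- move=> y Hy i; have := Hy i; rewrite !in_side /= !mxE.
  have [_ _ h1 [_ _ h2]] := aP i; move=> /andP[h3 h4]; apply/andP; split.
    move: h3; have [? h3|h7] := ltP (corner Q ord0 i) (a i) => /=.
      by apply: lteifS; apply: lt_le_trans (lteifW h3).
    by have -> : a i = corner Q ord0 i by lra.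
  move: h4; have [? h4|h7] := ltP (a i + 2 * side D) (corner Q ord0 i + side Q).
    by apply: lteifS; apply: le_lt_trans (lteifW h4) _.
  by have -> : a i + 2 * side D = corner Q ord0 i + side Q by lra.
Qed.

Lemma triple_side_gt0 Q : 0 < 3 * side Q.
Proof. by rewrite mulr_gt0 // side_gt0. Qed.

Definition triple Q : cube :=
  Cube (\row_i (corner Q ord0 i - side Q)) (fun=> true) (fun=> false)
    (triple_side_gt0 Q).

Lemma vol_triple Q : vol (triple Q) = 3 ^+ n * vol Q.
Proof. by rewrite /vol /= exprMn. Qed.

Lemma sub_triple P Q x : cset P x -> cset Q x -> side P <= side Q ->
  cset P `<=` cset (triple Q).
Proof.
move=> Px Qx PQ y Py i; rewrite in_side /= mxE.
have := cset_le i Px; have := cset_le i Qx; have := cset_le i Py.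
by move=> /andP[? ?] /andP[? ?] /andP[? ?]; apply/andP; split; lra.
Qed.

(** Greedy choice: every cube that meets the largest one lies in its triple, and the induction
    continues with the cubes disjoint from it. The chosen cubes are disjoint as sets, not just in
    their interiors, as [superadditive] demands. *)
Lemma vitali_cubes (I : finType) (P : I -> cube) (A : {set I}) :
  exists2 B : {set I}, B \subset A &
    trivIset [set` B] (fun i => cset (P i)) /\
    \bigcup_(i in [set` A]) cset (P i) `<=`
    \bigcup_(i in [set` B]) cset (triple (P i)).
Proof.
move: {2}(#|A|) (leqnn #|A|) => m; elim: m A => [|m IH] A.
  rewrite leqn0 cards_eq0 => /eqP ->; exists finset.set0; first exact: finset.sub0set.
  by split => [i j /=|x [i /=]]; rewrite finset.in_set0.
move=> Am; have [->|[i0 Ai0]] := set_0Vmem A.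
  exists finset.set0; first exact: finset.sub0set.
  by split => [i j /=|x [i /=]]; rewrite finset.in_set0.
pose j := [arg max_(i > i0 in A) side (P i)]%O.
have [Aj jmax] : j \in A /\ forall i, i \in A -> side (P i) <= side (P j).
  by rewrite /j; case: arg_maxP => // k Ak kmax; split.
pose A' := [set i in A | `[< cset (P i) `&` cset (P j) = set0 >]]%SET.
have [|B BA' [tB cB]] := IH A'.
  rewrite -ltnS; apply: leq_trans Am; apply: proper_card.
  apply/properP; split; first by apply/fintype.subsetP => i; rewrite inE => /andP[].
  exists j => //; rewrite inE Aj /= setIid; apply/negP => /asboolP.
  by apply/eqP/set0P/cset_neq0.
exists (j |: B)%SET.
  rewrite finset.subUset finset.sub1set Aj; apply: fintype.subset_trans BA' _.
  by apply/fintype.subsetP => i; rewrite inE => /andP[].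
have Bdisj i : i \in B -> cset (P i) `&` cset (P j) = set0.
  by move/(fintype.subsetP BA'); rewrite inE => /andP[_ /asboolP].
split.
  move=> i k /=; rewrite !in_setU1 => /orP[/eqP ->|iB] /orP[/eqP ->|kB] //.
  - by rewrite setIC Bdisj // => -[].
  - by rewrite Bdisj // => -[].
  - exact: tB.
move=> x [i /= iA xi].
have [ij0|/eqP/set0P[y [yi yj]]] := pselect (cset (P i) `&` cset (P j) = set0).
  have [|k /= kB kx] := cB x.
    by exists i => //=; rewrite inE iA; apply/asboolP.
  by exists k => //=; rewrite in_setU1 kB orbT.
exists j; first by rewrite /= in_setU1 eqxx.
exact: (sub_triple yi yj (jmax _ iA)).
Qed.

End cubes.

(** * Stopping times on the dyadic tree *)

Section stopping.
Local Open Scope ring_scope.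
Context (R : realType) (n : nat).
Implicit Types (P Q D : cube R n) (bad : pred (cube R n)) (x : 'rV[R]_n).

(** Calderon-Zygmund selection cut off at generation m: the recursion halts at the first bad cube,
    so the selected cubes are the maximal ones. [stopvol] carries their total volume as a real
    number, which keeps measure theory out of the good-lambda induction. *)
Fixpoint stopset bad m Q : set 'rV[R]_n :=
  if bad Q then cset Q else
  if m is m'.+1 then \bigcup_e stopset bad m' (child Q e) else set0.

Fixpoint stopvol bad m Q : R :=
  if bad Q then vol Q else
  if m is m'.+1 then \sum_e stopvol bad m' (child Q e) else 0.

Lemma stopset0 bad Q : stopset bad 0 Q = if bad Q then cset Q else set0.
Proof. by []. Qed.

Lemma stopsetS bad m Q : stopset bad m.+1 Q =
  if bad Q then cset Q else \bigcup_e stopset bad m (child Q e).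
Proof. by []. Qed.

Lemma sum_vol_child Q : \sum_e vol (child Q e) = vol Q.
Proof.
under eq_bigr do rewrite vol_child.
rewrite sumr_const card_ffun card_bool card_ord -[LHS]mulr_natr natrX divfK // expf_neq0.
Qed.

Lemma stopvol_bad bad m Q : bad Q -> stopvol bad m Q = vol Q.
Proof. by case: m => [|m] /= ->. Qed.

Lemma stopvol_le_vol bad m Q : stopvol bad m Q <= vol Q.
Proof.
elim: m Q => [|m IH] Q /=; case: ifP => _ //; first exact/ltW/vol_gt0.
by rewrite -[leRHS]sum_vol_child ler_sum.
Qed.

Lemma sub_stopset bad m Q : stopset bad m Q `<=` cset Q.
Proof.
elim: m Q => [|m IH] Q /=; case: ifP => _ //.
by move=> x [e _ /IH]; exact: sub_child.
Qed.

Lemma measurable_stopset bad m Q :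
  measurable (stopset bad m Q : set (Rn R n)).
Proof.
elim: m Q => [|m IH] Q /=; case: ifP => _ //; try exact: measurable_cset.
exact: fin_bigcup_measurable.
Qed.

Lemma stopset_nondecreasing bad Q : nondecreasing_seq (stopset bad ^~ Q).
Proof.
apply/nondecreasing_seqP => m; apply/subsetPset.
elim: m Q => [|m IH] Q /=; first by case: ifP => _ //; exact: sub0set.
by case: ifP => _ // x [e _ /IH ex]; exists e.
Qed.

Lemma leb_bigcup_le (I : finType) (A : {set I}) (F : I -> set (Rn R n)) :
  (forall i, measurable (F i)) ->
  (leb R n (\bigcup_(i in [set` A]) F i) <= \sum_(i in A) leb R n (F i))%E.
Proof.
move=> mF; rewrite bigcup_pred.
suff [] : measurable (\big[setU/set0]_(i in A) F i) /\
  (leb R n (\big[setU/set0]_(i in A) F i) <= \sum_(i in A) leb R n (F i))%E by [].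
apply: (big_ind2 (fun (X : set (Rn R n)) s => measurable X /\ (leb R n X <= s)%E)).
- by rewrite measure0.
- move=> X s Y t [mX Xs] [mY Yt]; split; first exact: measurableU.
  by apply: le_trans (leeD Xs Yt); exact: measureU2.
- by [].
Qed.

Lemma leb_stopset bad m Q :
  (leb R n (stopset bad m Q) <= (stopvol bad m Q)%:E)%E.
Proof.
elim: m Q => [|m IH] Q; rewrite ?stopset0 ?stopsetS [stopvol _ _ _]/=.
  by case: ifP => _; rewrite ?leb_cset // measure0.
case: ifP => _; first by rewrite leb_cset.
rewrite -sumEFin.
have -> : \bigcup_e stopset bad m (child Q e) =
    \bigcup_(e in [set` [set: {ffun 'I_n -> bool}]%SET]) stopset bad m (child Q e).
  apply/seteqP; split => x [e _ ex]; exists e => //=.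
  by rewrite finset.in_setT.
apply: le_trans (leb_bigcup_le _ _) _.
  by move=> e; exact: measurable_stopset.
by rewrite (eq_bigl xpredT) ?lee_sum // => e; rewrite finset.in_setT.
Qed.

(** D is the dyadic cube of generation k around x. The predicate is quantified after D because
    [avg_gt_stopset] finds out only later which of two predicates D satisfies. *)
Lemma dyadic_cube Q k x : cset Q x -> exists D,
  [/\ cset D x, cset D `<=` cset Q, side D = side Q / 2 ^+ k &
      forall bad, bad D -> stopset bad k Q x].
Proof.
elim: k Q => [|k IH] Q Qx.
  by exists Q; split => //; [rewrite divr1|move=> bad /= ->].
have [e ex] := cset_child Qx.
have [D [Dx De sD bD]] := IH _ ex.
exists D; split => //.
- exact: subset_trans De (@sub_child _ _ _ _).
- by rewrite sD /= exprS invfM mulrA.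
- move=> bad bD' /=; case: ifP => // _; exists e => //; exact: bD.
Qed.

(** The weak (1,1) bound of the dyadic maximal function: each selected cube P consumes tau |P| of
    [eta], and superadditivity under subdivision prevents [eta] from being spent twice. *)
Lemma stopvol_weak bad (eta : cube R n -> R) (tau : R) m Q :
  (forall P, cset P `<=` cset Q -> 0 <= eta P) ->
  (forall P, cset P `<=` cset Q -> \sum_e eta (child P e) <= eta P) ->
  (forall P, cset P `<=` cset Q -> bad P -> tau * vol P <= eta P) ->
  tau * stopvol bad m Q <= eta Q.
Proof.
move=> eta0 etaD etab.
suff H P : cset P `<=` cset Q -> tau * stopvol bad m P <= eta P by exact: H.
elim: m P => [|m IH] P PQ /=; case: ifP => bP; try exact: etab.
  by rewrite mulr0 eta0.
rewrite mulr_sumr; apply: le_trans (etaD _ PQ); apply: ler_sum => e _.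
exact/IH/(subset_trans _ PQ)/sub_child.
Qed.

End stopping.

(** * The John-Nirenberg inequality for abstract averages and oscillations *)

Definition decay_ratio (R : realType) (r : R) : R := ((2 `^ r)^-1)%R.

(** Small enough for two purposes: 2^n g <= 1/2, as [good_lambda] requires, and 2 g <= rho / 2, so
    that its carried-over term uses at most half of the decay rho = 2^(-r) per doubling of the
    level. *)
Definition osc_threshold (R : realType) (n : nat) (r : R) : R :=
  (decay_ratio r / 4 / 2 ^+ n)%R.

(* The first summand comes from the good-lambda iteration, the second one from the
   Vitali covering of the cubes with large oscillation. *)
Definition weak_const (R : realType) (n : nat) (r : R) : R :=
  (2 * (decay_ratio r)^-1 * (osc_threshold n r `^ r)^-1 +
   3 ^+ n * (2 * 4 ^+ n) `^ r)%R.

Section john_nirenberg.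
Local Open Scope ring_scope.
Context (R : realType) (n : nat) (r : R) (Q0 : cube R n).
(* [dev c P] stands for the integral of |g - c| over P, and [kappa P] for a
   superadditive majorant of |P| (osc P)^r, such as the supremum over the packings
   of P of the sums of these quantities. *)
Context (avg : cube R n -> R) (dev : R -> cube R n -> R) (kappa : cube R n -> R).
Implicit Types (P Q D : cube R n) (x : 'rV[R]_n).

Definition osc P := dev (avg P) P / vol P.

(** Arbitrary finite disjoint families are allowed: good-lambda needs only the children of a cube,
    but the Vitali subfamily in [leb_near_large_osc] is not dyadic. *)
Definition superadditive := forall (I : finType) (A : {set I})
    (P : I -> cube R n) Q, cset Q `<=` cset Q0 ->
  (forall i, i \in A -> cset (P i) `<=` cset Q) ->
  trivIset [set` A] (fun i => cset (P i)) ->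
  \sum_(i in A) kappa (P i) <= kappa Q.

Hypothesis r_gt0 : 0 < r.
Hypothesis dev_ge0 : forall c P, 0 <= dev c P.
Hypothesis dev_child : forall c P, cset P `<=` cset Q0 ->
  \sum_e dev c (child P e) <= dev c P.
Hypothesis dev_mono : forall c P D, cset P `<=` cset D ->
  cset D `<=` cset Q0 -> dev c P <= dev c D.
Hypothesis avg_dev : forall c P, cset P `<=` cset Q0 ->
  `|avg P - c| * vol P <= dev c P.
Hypothesis kappa_ge0 : forall P, 0 <= kappa P.
Hypothesis kappa_super : superadditive.
Hypothesis kappa_osc : forall P, cset P `<=` cset Q0 ->
  vol P * osc P `^ r <= kappa P.

Lemma kappa_child P : cset P `<=` cset Q0 ->
  \sum_e kappa (child P e) <= kappa P.
Proof.
move=> PQ0; have := @kappa_super _ [set: {ffun 'I_n -> bool}]%SET (child P) P PQ0.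
rewrite (eq_bigl xpredT) => [|e]; last by rewrite inE.
apply=> [e _|]; first exact: sub_child.
by move=> i j _ _; apply: trivIset_child.
Qed.

Lemma osc_ge0 P : 0 <= osc P.
Proof. by rewrite divr_ge0 // ltW // vol_gt0. Qed.

Lemma vol_le_kappa P (t : R) : 0 < t -> cset P `<=` cset Q0 -> t < osc P ->
  vol P <= kappa P / t `^ r.
Proof.
move=> t0 PQ0 tP; rewrite ler_pdivlMr ?powR_gt0 //.
apply: le_trans (kappa_osc PQ0).
by rewrite ler_pM2l ?vol_gt0 // ge0_ler_powR ?nnegrE ?osc_ge0 // ltW.
Qed.

Lemma avg_child_le P e : cset P `<=` cset Q0 ->
  avg (child P e) <= avg P + 2 ^+ n * osc P.
Proof.
move=> PQ0.
have := avg_dev (avg P) (subset_trans (@sub_child _ _ P e) PQ0).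
rewrite -ler_pdivlMr ?vol_gt0 // => h.
rewrite -lerBlDl; apply: le_trans (ler_norm _) _; apply: le_trans h _.
rewrite vol_child invf_div mulrCA ler_pM2l ?exprn_gt0 // /osc.
rewrite ler_pM2r ?invr_gt0 ?vol_gt0 //.
apply: le_trans (dev_child _ PQ0).
by rewrite (bigD1 e) //= lerDl sumr_ge0.
Qed.

(* If osc Q <= g (nu - mu), a child whose average exceeds mu has average at most
   (mu + nu) / 2, so the weak (1,1) bound applies to [dev] on it; a cube with
   larger oscillation is charged to kappa. *)
Lemma good_lambda (g mu nu : R) m Q : 0 < g -> 2 ^+ n * g <= 2^-1 -> mu < nu ->
  cset Q `<=` cset Q0 -> avg Q <= mu ->
  stopvol (fun P => nu < avg P) m Q <=
  kappa Q / (g * (nu - mu)) `^ r + 2 * g * stopvol (fun P => mu < avg P) m Q.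
Proof.
move=> g0 gn munu.
have d0 : 0 < nu - mu by rewrite subr_gt0.
have gd0 : 0 < g * (nu - mu) by rewrite mulr_gt0.
elim: m Q => [|m IH] Q QQ0 avgQ /=.
  rewrite !ltNge avgQ (le_trans avgQ (ltW munu)) /= mulr0 addr0.
  by rewrite divr_ge0 // powR_ge0.
rewrite !ltNge avgQ (le_trans avgQ (ltW munu)) /=.
have sv0 bad k P : 0 <= 2 * g * stopvol bad k P.
  rewrite mulr_ge0 ?mulr_ge0 ?(ltW g0) //.
  elim: k P => [|k IHk] P /=; case: ifP => _ //; rewrite ?(ltW (vol_gt0 _)) //.
  by apply: sumr_ge0 => e _; exact: IHk.
have [oscQ|oscQ] := ltP (g * (nu - mu)) (osc Q).
  apply: le_trans (_ : vol Q <= _).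
    by rewrite -[leRHS]sum_vol_child ler_sum // => e _; exact: stopvol_le_vol.
  apply: le_trans (vol_le_kappa gd0 QQ0 oscQ) _.
  by rewrite lerDl mulr_sumr; apply: sumr_ge0.
apply: le_trans (_ : \sum_e (kappa (child Q e) / (g * (nu - mu)) `^ r +
    2 * g * stopvol (fun P => mu < avg P) m (child Q e)) <= _); last first.
  rewrite big_split /= -mulr_suml -mulr_sumr lerD2r.
  by rewrite ler_pM2r ?invr_gt0 ?powR_gt0 // kappa_child.
apply: ler_sum => e _.
have eQ0 : cset (child Q e) `<=` cset Q0.
  exact: subset_trans (@sub_child _ _ _ _) QQ0.
have [avge|avge] := leP (avg (child Q e)) mu; first exact: IH.
have [osce|osce] := ltP (g * (nu - mu)) (osc (child Q e)).
  apply: le_trans (stopvol_le_vol _ _ _) _.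
  by apply: le_trans (vol_le_kappa gd0 eQ0 osce) _; rewrite lerDl.
(* The child is itself selected at level [mu], so its whole volume is available on the right. As
   [nu] exceeds its average by at least half the gap and its oscillation is at most g (nu - mu), the
   weak bound leaves the factor 2 g. *)
rewrite (@stopvol_bad _ _ (fun P => mu < avg P)) //.
apply: ler_wpDl; first by rewrite divr_ge0 // powR_ge0.
have avge2 : avg (child Q e) <= mu + (nu - mu) / 2.
  apply: le_trans (avg_child_le e QQ0) _; apply: lerD => //.
  apply: le_trans (_ : 2 ^+ n * (g * (nu - mu)) <= _).
    by rewrite ler_pM2l // exprn_gt0.
  by rewrite mulrA [leRHS]mulrC ler_pM2r.
have : (nu - mu) / 2 * stopvol (fun P => nu < avg P) m (child Q e) <=
    dev (avg (child Q e)) (child Q e).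
  apply: stopvol_weak => // P Pe.
    by apply: dev_child; exact: subset_trans Pe eQ0.
  move=> nuP; apply: le_trans (avg_dev _ (subset_trans Pe eQ0)).
  rewrite ler_pM2r ?vol_gt0 //; apply: le_trans (ler_norm _); lra.
have -> : dev (avg (child Q e)) (child Q e) = osc (child Q e) * vol (child Q e).
  by rewrite /osc divfK // gt_eqF // vol_gt0.
move=> h; have {}h := le_trans h (ler_wpM2r (ltW (vol_gt0 _)) osce).
rewrite -(@ler_pM2l _ ((nu - mu) / 2)) ?divr_gt0 //; apply: le_trans h _.
by rewrite le_eqVlt; apply/orP; left; apply/eqP; field.
Qed.

(** The cubes P of large oscillation need be neither dyadic nor countably many. Marking the dyadic
    cubes that lie inside one of them keeps each stopped set a finite union of cubes, hence
    measurable and within reach of the finite Vitali lemma. *)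
Definition near_large_osc (t : R) : pred (cube R n) := fun D =>
  `[< exists P, [/\ cset D `<=` cset P, cset P `<=` cset Q0 & t < osc P] >].

Lemma near_large_osc_cover t m Q : exists (I : finType) (P : I -> cube R n),
  (forall i, cset (P i) `<=` cset Q0 /\ t < osc (P i)) /\
  stopset (near_large_osc t) m Q `<=` \bigcup_i cset (P i).
Proof.
have base D : near_large_osc t D -> exists (I : finType) (P : I -> cube R n),
    (forall i, cset (P i) `<=` cset Q0 /\ t < osc (P i)) /\
    cset D `<=` \bigcup_i cset (P i).
  move=> /asboolP[P [DP PQ tP]]; exists unit, (fun=> P); split => // x Dx.
  by exists tt => //; exact: DP.
elim: m Q => [|m IH] Q; rewrite ?stopset0 ?stopsetS; case: ifPn => [/base //|_].
  by exists void, (of_void _); split => // -[].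
have {}IH e : exists F : {I : finType & I -> cube R n},
    (forall i, cset (projT2 F i) `<=` cset Q0 /\ t < osc (projT2 F i)) /\
    stopset (near_large_osc t) m (child Q e) `<=` \bigcup_i cset (projT2 F i).
  by have [I [P IP]] := IH (child Q e); exists (existT _ I P).
have [F FP] := choice IH.
exists {e : {ffun 'I_n -> bool} & projT1 (F e)}.
exists (fun i => projT2 (F (tag i)) (tagged i)); split.
  by move=> [e i]; exact: (FP e).1.
move=> x [e _ /(FP e).2[i _ ix]].
by exists (Tagged (fun e => projT1 (F e)) i).
Qed.

(** The large-oscillation cubes that cover the stopped set may overlap, so [kappa] cannot be summed
    over them; passing to a disjoint subfamily costs the factor 3^n of the triples. *)
Lemma leb_near_large_osc t m : 0 < t ->
  (leb R n (stopset (near_large_osc t) m Q0) <=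
   (3 ^+ n * (kappa Q0 / t `^ r))%:E)%E.
Proof.
move=> t0; have [I [P [PQ cP]]] := near_large_osc_cover t m Q0.
have [B _ [tB cB]] := vitali_cubes P [set: I]%SET.
apply: le_trans (_ : leb R n (\bigcup_(i in [set` B]) cset (triple (P i))) <= _)%E.
  apply: le_measure; rewrite ?inE.
  - exact: measurable_stopset.
  - by apply: fin_bigcup_measurable => // i _; exact: measurable_cset.
  - apply: subset_trans cP _; apply: subset_trans cB => x [i _ ix].
    by exists i => //=; rewrite finset.in_setT.
apply: le_trans (leb_bigcup_le _ _) _; first by move=> i; exact: measurable_cset.
under eq_bigr do rewrite leb_cset vol_triple.
rewrite sumEFin lee_fin -mulr_sumr ler_pM2l ?exprn_gt0 //.
apply: le_trans (_ : \sum_(i in B) kappa (P i) / t `^ r <= _).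
  by apply: ler_sum => i _; apply: vol_le_kappa => //; have [] := PQ i.
rewrite -mulr_suml ler_pM2r ?invr_gt0 ?powR_gt0 //.
by apply: kappa_super => // i _; have [] := PQ i.
Qed.

Lemma dyadic_scale (s t : R) : 0 < s -> s <= t ->
  exists k, s <= t / 2 ^+ k < 2 * s.
Proof.
move=> s0 st; have t0 := lt_le_trans s0 st.
have ex : exists k, t / 2 ^+ k < 2 * s.
  have := @archi_boundP _ (t / s) (ltW (divr_gt0 t0 s0)).
  set N := Num.bound _ => tN; exists N.
  rewrite ltr_pdivrMr ?exprn_gt0 //; move: tN; rewrite ltr_pdivrMr // => tN.
  have bN : (N%:R : R) < 2 ^+ N by rewrite -natrX ltr_nat ltn_expl.
  have h1 : 0 < s * (2 ^+ N - N%:R) by rewrite mulr_gt0 // subr_gt0.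
  have h2 : 0 < s * 2 ^+ N by rewrite mulr_gt0 // exprn_gt0.
  lra.
have [[|k] kP kmin] := ex_minnP ex.
  by exists 0%N; rewrite kP expr0 divr1 st.
exists k.+1; rewrite kP andbT leNgt; apply/negP => h.
suff : (k < k)%N by rewrite ltnn.
apply: kmin.
have -> : t / 2 ^+ k = 2 * (t / 2 ^+ k.+1).
  by rewrite exprS; field; rewrite expf_neq0.
by rewrite ltr_pM2l.
Qed.

(* P is compared with a dyadic cube around x through a cube containing both. *)
Lemma avg_gt_stopset (l : R) P x : (0 < n)%N -> 0 < l ->
  cset P `<=` cset Q0 -> cset P x -> avg Q0 + 2 * l < avg P ->
  exists k, stopset (fun D => avg Q0 + l < avg D) k Q0 x \/
    stopset (near_large_osc (l / (2 * 4 ^+ n))) k Q0 x.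
Proof.
move=> n0 l1 PQ Px avgP.
have P0 := side_gt0 P.
have [k /andP[k1 k2]] := dyadic_scale P0 (sub_cset_side n0 PQ).
have [D [Dx DQ sD bD]] := dyadic_cube k (PQ _ Px).
have [H [PH DH HQ sH]] : exists H, [/\ cset P `<=` cset H, cset D `<=` cset H,
    cset H `<=` cset Q0 & side H <= 2 * side D].
  (* A hull of side [2 * side D] needs room in Q0; when there is none, Q0 itself is short enough to
     serve as H. *)
  have [h|h] := leP (2 * side D) (side Q0).
    have [|H [? ? ? sH]] := cube_hull Px Dx PQ DQ _ h; first by rewrite sD.
    by exists H; split => //; rewrite sH.
  by exists Q0; split => //; exact: ltW.
have D0 := side_gt0 D; have H0 := side_gt0 H.
(* Since [side P <= side D < 2 * side P], the cube H is at most 4 times as long as P or D. Replacing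
   P by H and H by D then changes the average by at most 4^n osc H each time; the threshold l / (2 *
   4^n) makes each change at most l / 2, which lowers 2 l to l. *)
have vHD : vol H <= 4 ^+ n * vol D.
  rewrite -exprMn lerXn2r ?nnegrE ?mulr_ge0 ?(ltW D0) ?(ltW H0) //; lra.
have vHP : vol H <= 4 ^+ n * vol P.
  rewrite -exprMn lerXn2r ?nnegrE ?mulr_ge0 ?(ltW P0) ?(ltW H0) //.
  by rewrite -sD in k2; lra.
have devle A : cset A `<=` cset H -> vol H <= 4 ^+ n * vol A ->
    `|avg A - avg H| <= 4 ^+ n * osc H.
  move=> AH vA; have h := avg_dev (avg H) (subset_trans AH HQ).
  rewrite -ler_pdivlMr ?vol_gt0 // in h; apply: le_trans h _.
  apply: le_trans (_ : dev (avg H) H / vol A <= _).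
    by rewrite ler_pM2r ?invr_gt0 ?vol_gt0 //; exact: dev_mono.
  rewrite /osc mulrCA; apply: ler_wpM2l => //.
  by rewrite ler_pdivlMr ?vol_gt0 // mulrC ler_pdivrMr ?vol_gt0.
have dP := devle _ PH vHP; have dD := devle _ DH vHD.
exists k; have [oH|oH] := ltP (l / (2 * 4 ^+ n)) (osc H).
  by right; apply: bD; apply/asboolP; exists H.
left; apply: bD.
have : 4 ^+ n * osc H <= l / 2.
  have h4 : 0 < 4 ^+ n :> R by rewrite exprn_gt0.
  rewrite mulrC -ler_pdivlMr //; apply: le_trans oH _.
  by rewrite invfM mulrA.
move: dP dD; rewrite !ler_norml => /andP[_ dP] /andP[dD _]; lra.
Qed.

Context (l0 : R) (l0_gt0 : 0 < l0) (kappa_Q0 : kappa Q0 <= l0 `^ r * vol Q0).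

Local Notation rho := (decay_ratio r).
Local Notation g := (osc_threshold n r).

(** With B = 2 rho^-1 g^-r, one application of [good_lambda] between consecutive levels splits the
    target B rho^(k+1) into two halves: the charge to [kappa] is g^-r rho^k = B rho^(k+1) / 2, and 2
    g <= rho / 2 handles the carried-over term. *)
Lemma avg_stopvol_decay k m :
  stopvol (fun P => avg Q0 + 2 ^+ k * l0 < avg P) m Q0 <=
  2 * rho^-1 * (g `^ r)^-1 * vol Q0 * rho ^+ k.
Proof.
have p2 : 1 <= 2 `^ r :> R by rewrite -[leLHS](powRr0 2) ler_powR ?ler1n // ltW.
have rho0 : 0 < rho by rewrite invr_gt0 powR_gt0.
have rho1 : rho <= 1 by rewrite invf_le1 ?powR_gt0.
have n0 : 0 < 2 ^+ n :> R by rewrite exprn_gt0.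
have n1 : 1 <= 2 ^+ n :> R by rewrite exprn_ege1 // ler1n.
have g0 : 0 < g by rewrite !divr_gt0.
have gn : 2 ^+ n * g = rho / 4 by rewrite /osc_threshold mulrC divfK // gt_eqF.
have g1 : g <= rho / 4 by rewrite ler_pdivrMr // ler_peMr // divr_ge0 // ltW.
have gr1 : 1 <= (g `^ r)^-1.
  have g1r : 1 `^ r = 1 :> R by rewrite powR1.
  by rewrite invf_ge1 ?powR_gt0 // -[leRHS]g1r ge0_ler_powR ?nnegrE ?ltW //; lra.
have V0 := vol_gt0 Q0.
elim: k => [|k IH].
  rewrite expr0 mulr1; apply: le_trans (stopvol_le_vol _ _ _) _.
  rewrite ler_peMl ?(ltW V0) //.
  have : 1 <= 2 * rho^-1 by rewrite /decay_ratio invrK; lra.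
  by move=> h; rewrite -[leLHS]mulr1 ler_pM.
set B := 2 * rho^-1 * (g `^ r)^-1 in IH *.
have l2 j : 0 < 2 ^+ j * l0 by rewrite mulr_gt0 // exprn_gt0.
apply: le_trans (@good_lambda g (avg Q0 + 2 ^+ k * l0) _ m Q0 g0 _ _ _ _) _ => //.
- by rewrite gn; lra.
- by rewrite ltrD2l ltr_pM2r // exprS ltr_pMl ?exprn_gt0 // ltr1n.
- by rewrite lerDl ltW.
have -> : avg Q0 + 2 ^+ k.+1 * l0 - (avg Q0 + 2 ^+ k * l0) = 2 ^+ k * l0.
  by rewrite exprS; ring.
apply: le_trans (_ : (g `^ r)^-1 * vol Q0 * rho ^+ k +
   2 * g * (B * vol Q0 * rho ^+ k) <= _).
  apply: lerD; last by rewrite ler_pM2l // mulr_gt0.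
  rewrite ler_pdivrMr ?powR_gt0 ?mulr_gt0 //.
  rewrite powRM ?(ltW g0) ?(ltW (l2 k)) // powRM ?exprn_ge0 ?(ltW l0_gt0) //.
  have -> : (2 ^+ k) `^ r = (2 `^ r) ^+ k :> R.
    by rewrite -powR_mulrn // -powRrM mulrC powRrM powR_mulrn ?powR_ge0.
  apply: le_trans kappa_Q0 _; rewrite /decay_ratio exprVn.
  rewrite le_eqVlt; apply/orP; left; apply/eqP; field.
  by rewrite !gt_eqF ?exprn_gt0 ?powR_gt0.
rewrite exprS.
have -> : (g `^ r)^-1 = B * rho / 2 by rewrite /B; field; rewrite !gt_eqF ?powR_gt0.
have B0 : 0 < B by rewrite /B !mulr_gt0 ?invr_gt0 ?powR_gt0.
rewrite -subr_ge0.
have -> : B * vol Q0 * (rho * rho ^+ k) -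
  (B * rho / 2 * vol Q0 * rho ^+ k + 2 * g * (B * vol Q0 * rho ^+ k)) =
  B * vol Q0 * rho ^+ k * (rho / 2 - 2 * g) by field.
apply: mulr_ge0; last by lra.
by apply: mulr_ge0; [exact: mulr_ge0 (ltW B0) (ltW V0)|exact: exprn_ge0 (ltW rho0)].
Qed.

Lemma leb_bigcup_nondecreasing_le (F : nat -> set (Rn R n)) (b : \bar R) :
  (forall m, measurable (F m)) -> nondecreasing_seq F ->
  (forall m, leb R n (F m) <= b)%E -> (leb R n (\bigcup_m F m) <= b)%E.
Proof.
move=> mF ndF Fb.
have /(_ _ (leb R n)) cF := nondecreasing_cvg_mu mF (bigcup_measurable (fun k _ => mF k)) ndF.
rewrite -(cvg_lim (@ereal_hausdorff R) cF).
by apply: lime_le; [apply/cvg_ex; eexists; exact: cF|exact: nearW].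
Qed.

(** The bounds at depth m do not involve m and the stopped sets increase with m, so they survive in
    the union. The two sets united in E k account for the two summands of [weak_const]. *)
Lemma avg_weak_type : (0 < n)%N -> exists E : nat -> set (Rn R n), forall k,
  [/\ measurable (E k), E k `<=` cset Q0,
      (leb R n (E k) <= (weak_const n r * vol Q0 * rho ^+ k)%:E)%E &
      forall P x, cset P `<=` cset Q0 -> cset P x ->
        avg Q0 + 2 * (2 ^+ k * l0) < avg P -> E k x].
Proof.
move=> n0.
pose l k := 2 ^+ k * l0.
have l_gt0 k : 0 < l k by rewrite mulr_gt0 // exprn_gt0.
pose A k : set (Rn R n) :=
  \bigcup_m stopset (fun D => avg Q0 + l k < avg D) m Q0.
pose B k : set (Rn R n) :=
  \bigcup_m stopset (near_large_osc (l k / (2 * 4 ^+ n))) m Q0.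
have mA k : measurable (A k).
  by apply: bigcup_measurable => m _; exact: measurable_stopset.
have mB k : measurable (B k).
  by apply: bigcup_measurable => m _; exact: measurable_stopset.
exists (fun k => A k `|` B k) => k; split.
- exact: measurableU.
- by move=> x [|] [m _]; exact: sub_stopset.
- apply: le_trans (measureU2 _ (mA k) (mB k)) _.
  rewrite /weak_const (mulrDl _ _ (vol Q0)) (mulrDl _ _ (rho ^+ k)) EFinD.
  apply: leeD.
  + apply: leb_bigcup_nondecreasing_le.
    * by move=> m; exact: measurable_stopset.
    * exact: stopset_nondecreasing.
    * move=> m; apply: le_trans (leb_stopset _ _ _) _.
      by rewrite lee_fin; exact: avg_stopvol_decay.
  + apply: leb_bigcup_nondecreasing_le.
    * by move=> m; exact: measurable_stopset.
    * exact: stopset_nondecreasing.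
    * have h4 : 0 < 2 * 4 ^+ n :> R by rewrite mulr_gt0 // exprn_gt0.
      move=> m; apply: le_trans (leb_near_large_osc _ _) _.
        by rewrite divr_gt0.
      have lE : (l k / (2 * 4 ^+ n)) `^ r =
          (2 `^ r) ^+ k * l0 `^ r / (2 * 4 ^+ n) `^ r.
        rewrite powRM ?invr_ge0 ?(ltW (l_gt0 k)) ?(ltW h4) //.
        rewrite /l powRM ?exprn_ge0 ?(ltW l0_gt0) //; congr (_ * _ * _).
          by rewrite -powR_mulrn // -powRrM mulrC powRrM powR_mulrn ?powR_ge0.
        by rewrite -powR_inv1 ?(ltW h4) // -powRrM mulN1r powRN.
      rewrite lee_fin lE; set c := (2 * 4 ^+ n) `^ r.
      have c0 : 0 < c by rewrite powR_gt0.
      apply: le_trans (_ : 3 ^+ n *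
          (l0 `^ r * vol Q0 / ((2 `^ r) ^+ k * l0 `^ r / c)) <= _).
        rewrite ler_pM2l ?exprn_gt0 // ler_pM2r //.
        by rewrite invr_gt0 divr_gt0 // mulr_gt0 ?exprn_gt0 ?powR_gt0.
      rewrite /decay_ratio exprVn le_eqVlt; apply/orP; left; apply/eqP; field.
      by rewrite !gt_eqF ?exprn_gt0 ?powR_gt0.
- move=> P x PQ Px avgP.
  have [m [h|h]] := avg_gt_stopset n0 (l_gt0 k) PQ Px avgP.
    by left; exists m.
  by right; exists m.
Qed.

End john_nirenberg.

(** The integral of a nonnegative function is a supremum over the simple functions below it, and
    such a supremum is monotone without any measurability. *)
Lemma ge0_le_integral_nomeas d (T : measurableType d) (R : realType)
    (mu : {measure set T -> \bar R}) (D : set T) (f g : T -> \bar R) :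
  (forall x, D x -> 0 <= f x) -> (forall x, D x -> f x <= g x) ->
  \int[mu]_(x in D) f x <= \int[mu]_(x in D) g x.
Proof.
move=> f0 fg; have g0 x : D x -> 0 <= g x by move=> Dx; exact: le_trans (f0 _ Dx) (fg _ Dx).
rewrite !ge0_integralE //; apply: le_ereal_sup => _ [h hf <-]; exists h => // x.
apply: le_trans (hf x) _; rewrite /patch; case: ifP => // xD.
by apply: fg; rewrite inE in xD.
Qed.

(** * A majorant of the maximal function *)

Section averages.
Local Open Scope ring_scope.
Context (R : realType) (n : nat) (f : 'rV[R]_n -> R).
Implicit Types (P Q D : cube R n) (x : 'rV[R]_n).

(** Real-valued, to fit the abstract section above: an infinite integral becomes 0 by default, which
    is harmless because averages are only compared on cubes inside Q0, where f is integrable. *)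
Definition cavg P : R := (vol P)^-1 * \int[leb R n]_(x in cset P) `|f x|.

Definition cdev (c : R) P : R := \int[leb R n]_(x in cset P) `| `|f x| - c|.

Lemma cdev_ge0 c P : 0 <= cdev c P.
Proof. by apply: Rintegral_ge0. Qed.

Lemma cavg_ge0 P : 0 <= cavg P.
Proof. by rewrite mulr_ge0 ?invr_ge0 ?(ltW (vol_gt0 _)) //; apply: Rintegral_ge0. Qed.

Variable Q0 : cube R n.
Hypothesis fint : (leb R n).-integrable (cset Q0) (EFin \o f).

Lemma integrable_cst_cube (c : R) P :
  (leb R n).-integrable (cset P) (EFin \o cst c).
Proof.
apply/integrableP; split; first exact/measurable_EFinP/measurable_cst.
rewrite (_ : (fun _ => _) = cst `|c|%:E) // integral_cst; last exact: measurable_cset.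
by rewrite leb_cset ltry.
Qed.

Lemma integrable_sub_cube P : cset P `<=` cset Q0 ->
  (leb R n).-integrable (cset P) (EFin \o f).
Proof. by move=> PQ; apply: integrableS fint => //; exact: measurable_cset. Qed.

Lemma integrable_norm_sub (c : R) P : cset P `<=` cset Q0 ->
  (leb R n).-integrable (cset P) (EFin \o (fun x : Rn R n => `|f x| - c)).
Proof.
move=> PQ; have := integrable_norm (integrable_sub_cube PQ) => h1.
exact: (integrableB (measurable_cset P) h1 (integrable_cst_cube c P)).
Qed.

Lemma average_cavg P : cset P `<=` cset Q0 ->
  average (cset P) (fun y => `|f y|%:E) = (cavg P)%:E.
Proof.
move=> PQ; rewrite /average leb_cset /= /cavg /Rintegral EFinM fineK //.
apply: integrable_fin_num; first exact: measurable_cset.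
exact: integrable_norm (integrable_sub_cube PQ).
Qed.

Lemma cdevE c P : cset P `<=` cset Q0 ->
  ((cdev c P)%:E = \int[leb R n]_(x in cset P) (`| `|f x| - c|)%:E)%E.
Proof.
move=> PQ; rewrite /cdev /Rintegral fineK //.
apply: integrable_fin_num; first exact: measurable_cset.
exact: integrable_norm (integrable_norm_sub c PQ).
Qed.

Lemma cavg_dev c P : cset P `<=` cset Q0 ->
  `|cavg P - c| * vol P <= cdev c P.
Proof.
move=> PQ; have V0 := vol_gt0 P.
have -> : `|cavg P - c| * vol P = `|\int[leb R n]_(x in cset P) (`|f x| - c)|.
  rewrite RintegralB; first last.
  - exact: integrable_cst_cube.
  - exact: integrable_norm (integrable_sub_cube PQ).
  - exact: measurable_cset.
  rewrite Rintegral_cst; last exact: measurable_cset.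
  rewrite leb_cset /= -[X in _ * X = _](gtr0_norm V0) -normrM mulrBl /cavg.
  by rewrite mulrAC mulVf ?mul1r // gt_eqF.
apply: le_normr_Rintegral; first exact: measurable_cset.
exact: integrable_norm_sub.
Qed.

Lemma measurable_dev (c : R) P : cset P `<=` cset Q0 ->
  measurable_fun (cset P : set (Rn R n)) (EFin \o (fun x : Rn R n => `| `|f x| - c| : R)).
Proof.
by move=> PQ; have /measurable_int := integrable_norm (integrable_norm_sub c PQ).
Qed.

Lemma cdev_mono c P D : cset P `<=` cset D -> cset D `<=` cset Q0 ->
  cdev c P <= cdev c D.
Proof.
move=> PD DQ; rewrite -lee_fin !cdevE //; last exact: subset_trans DQ.
apply: ge0_subset_integral => //; try exact: measurable_cset.
exact: measurable_dev.
Qed.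

Lemma cdev_child c P : cset P `<=` cset Q0 ->
  \sum_e cdev c (child P e) <= cdev c P.
Proof.
move=> PQ; rewrite -lee_fin -sumEFin.
have eQ e : cset (child P e) `<=` cset Q0 by exact: subset_trans (@sub_child _ _ P e) PQ.
under eq_bigr do rewrite cdevE //.
have PE : \big[setU/set0]_(e <- index_enum {ffun 'I_n -> bool})
    (cset (child P e) : set (Rn R n)) `<=` cset P.
  by rewrite -bigcup_seq => x [e _]; exact: sub_child.
rewrite -ge0_integral_bigsetU //=.
- rewrite cdevE //; apply: ge0_subset_integral => //.
  + by apply: bigsetU_measurable => e _; exact: measurable_cset.
  + exact: measurable_cset.
  + exact: measurable_dev.
- by move=> e; exact: measurable_cset.
- exact: index_enum_uniq.
- by move=> e e' _ _; exact: trivIset_child.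
- apply: measurable_funS PE _; first exact: measurable_cset.
  exact: measurable_dev.
Qed.

Lemma maximal_gt x (y : R) : ((cavg Q0 + y)%:E < maximal (cset Q0) f x)%E ->
  exists P, [/\ cset P `<=` cset Q0, cset P x & cavg Q0 + y < cavg P].
Proof.
move=> /ereal_sup_gt[_ [A [/is_cubeP[P ->] Px PQ] <-]].
by rewrite average_cavg // lte_fin => yP; exists P.
Qed.

Lemma cavg_le_maximal x : cset Q0 x -> ((cavg Q0)%:E <= maximal (cset Q0) f x)%E.
Proof.
move=> Qx; rewrite -average_cavg //; apply: ereal_sup_ubound.
by exists (cset Q0) => //; split => //; exact: is_cube_cset.
Qed.

Context (q r : R) (q_ge1 : 1 <= q) (qr : q < r) (n_gt0 : (0 < n)%N).

Lemma geometric_sum_le (t : R) N : 0 <= t < 1 ->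
  \sum_(0 <= k < N) t ^+ k <= (1 - t)^-1.
Proof.
move=> /andP[t0 t1]; have t1' : 0 < 1 - t by rewrite subr_gt0.
rewrite -[leRHS]mul1r ler_pdivlMr //.
suff -> : (\sum_(0 <= k < N) t ^+ k) * (1 - t) = 1 - t ^+ N.
  by rewrite gerBl exprn_ge0.
elim: N => [|N IH]; first by rewrite big_geq // mul0r expr0 subrr.
by rewrite big_nat_recr //= mulrDl IH exprS; ring.
Qed.

(** The ratio 2^(q - r) of the layer sum: the integrand grows like 2^(k q) on layer k while its
    measure decays like 2^(-k r). This is where q < r makes the series converge. *)
Definition decay : R := 2 `^ q * decay_ratio r.

Lemma decay_lt1 : 0 <= decay < 1.
Proof.
rewrite /decay /decay_ratio mulr_ge0 ?invr_ge0 ?powR_ge0 //=.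
by rewrite ltr_pdivrMr ?powR_gt0 // mul1r /powR !pnatr_eq0 /= ltr_expR ltr_pM2r // ln_gt0 // ltr1n.
Qed.

Definition maximal_const : R :=
  2 `^ q + 4 `^ q * weak_const n r * (1 - decay)^-1.

Lemma maximal_majorant (kappa : cube R n -> R) (l0 : R) :
  (forall P, 0 <= kappa P) -> superadditive Q0 kappa ->
  (forall P, cset P `<=` cset Q0 ->
     vol P * osc cavg cdev P `^ r <= kappa P) ->
  0 < l0 -> kappa Q0 <= l0 `^ r * vol Q0 ->
  exists H : Rn R n -> \bar R,
    [/\ measurable_fun (cset Q0 : set (Rn R n)) H, (forall x, 0 <= H x)%E,
        (forall x, cset Q0 x ->
           `|maximal (cset Q0) f x - (cavg Q0)%:E| `^ q <= H x)%E &
        (\int[leb R n]_(x in cset Q0) H x <=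
           (maximal_const * vol Q0 * l0 `^ q)%:E)%E].
Proof.
move=> kappa0 kappaS kappa_osc l0_gt0 kappaQ.
have r0 : 0 < r by rewrite (lt_trans _ qr) // (lt_le_trans ltr01).
have q0 : 0 < q by rewrite (lt_le_trans ltr01).
have [E Ek] := @avg_weak_type R n r Q0 cavg cdev kappa r0 cdev_ge0 cdev_child
  cdev_mono cavg_dev kappa0 kappaS kappa_osc l0 l0_gt0 kappaQ n_gt0.
(* Layer k is where the maximal function exceeds the average by more than 2 (2^k l0) and at most 2
   (2^(k+1) l0) = 4 (2^k l0); it lies in E k. The bottom layer is paid for by the constant (2 l0)^q
   in [H]. *)
pose c k : R := (4 * (2 ^+ k * l0)) `^ q.
have c0 k : 0 <= c k by exact: powR_ge0.
pose S x : \bar R := (\sum_(0 <= k <oo) (c k)%:E * (\1_(E k) x)%:E)%E.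
have t0 k (x : Rn R n) : (0 <= (c k)%:E * (\1_(E k) x)%:E)%E.
  by rewrite mule_ge0 // lee_fin.
have S0 x : (0 <= S x)%E by apply: nneseries_ge0 => k _ _.
have Sge k x : E k x -> ((c k)%:E <= S x)%E.
  move=> Ekx; rewrite /S (@nneseriesD1 _ _ k) //.
  rewrite indicE mem_set // mule1 leeDl //.
  by apply: nneseries_ge0.
pose H x : \bar R := (((2 * l0) `^ q)%:E + S x)%E.
have mt k : measurable_fun (cset Q0 : set (Rn R n))
    (fun x => (c k)%:E * (\1_(E k) x)%:E)%E.
  apply: emeasurable_funM; first exact: measurable_cst.
  by apply/measurable_EFinP/measurable_indic; have [] := Ek k.
have mS : measurable_fun (cset Q0 : set (Rn R n)) S.
  exact: ge0_emeasurable_sum.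
exists H; split.
- by apply: emeasurable_funD => //; exact: measurable_cst.
- by move=> x; rewrite adde_ge0 // lee_fin powR_ge0.
- move=> x Qx; have := cavg_le_maximal Qx.
  have Ekx k : ((cavg Q0 + 2 * (2 ^+ k * l0))%:E < maximal (cset Q0) f x)%E ->
      E k x.
    move=> /maximal_gt[P [PQ Px yP]].
    by have [_ _ _ h] := Ek k; exact: h PQ Px yP.
  have lk0 k : 0 < 2 ^+ k * l0 by rewrite mulr_gt0 // exprn_gt0.
  have bigk (y : R) : exists k, y <= 2 * (2 ^+ k * l0).
    have := @archi_boundP _ (`|y| / l0) (divr_ge0 (normr_ge0 _) (ltW l0_gt0)).
    set N := Num.bound _ => yN; exists N.
    apply: le_trans (ler_norm _) _; move: yN; rewrite ltr_pdivrMr // => yN.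
    have bN : (N%:R : R) < 2 ^+ N by rewrite -natrX ltr_nat ltn_expl.
    have h1 : 0 < l0 * (2 ^+ N - N%:R) by rewrite mulr_gt0 // subr_gt0.
    have h2 : 0 < l0 * 2 ^+ N by rewrite mulr_gt0 // exprn_gt0.
    lra.
  case ME : (maximal (cset Q0) f x) => [m| |] //= mQ.
    rewrite lee_fin in mQ.
    rewrite ger0_norm ?subr_ge0 //.
    have [[|k] kP kmin] := ex_minnP (bigk (m - cavg Q0)).
      rewrite /H; apply: le_trans (leeDl _ (S0 x)); rewrite lee_fin.
      rewrite expr0 mul1r in kP.
      by rewrite ge0_ler_powR ?nnegrE ?subr_ge0 ?mulr_ge0 ?(ltW l0_gt0) ?(ltW q0).
    have /Ekx /Sge : ((cavg Q0 + 2 * (2 ^+ k * l0))%:E < maximal (cset Q0) f x)%E.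
      rewrite ME lte_fin ltNge; apply/negP => h.
      suff : (k < k)%N by rewrite ltnn.
      by apply: kmin; lra.
    move=> h; rewrite /H; apply: le_trans (leeDr _ _); last first.
      by rewrite lee_fin powR_ge0.
    apply: le_trans h; rewrite lee_fin /c.
    rewrite ge0_ler_powR ?nnegrE ?subr_ge0 ?(ltW q0) //.
      by rewrite mulr_ge0 // ltW.
    by rewrite exprS in kP; lra.
  (* Where the maximal function is +oo, x lies in every E k; the coefficients c k are unbounded, so
     [S x] is +oo as well. *)
  rewrite gt_eqF //.
  rewrite /H; apply: le_trans (leeDr _ _); last by rewrite lee_fin powR_ge0.
  rewrite leye_eq; apply/eqP/eqyP => A A0.
  have [k kP] := bigk (Num.max 1 A).
  have /Sge : E k x by apply: Ekx; rewrite ME ltry.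
  apply: le_trans; rewrite lee_fin /c.
  have h1 : 1 <= 4 * (2 ^+ k * l0).
    by move: kP; rewrite ge_max => /andP[? ?]; have := lk0 k; lra.
  apply: le_trans (le1r_powR h1 q_ge1).
  by move: kP; rewrite ge_max => /andP[? ?]; have := lk0 k; lra.
- have mQ := measurable_cset Q0.
  rewrite ge0_integralD //; last by move=> x _; rewrite lee_fin powR_ge0.
  rewrite integral_cst // leb_cset -EFinM /maximal_const (mulrDl _ _ (vol Q0)) (mulrDl _ _ (l0 `^ q)) EFinD.
  apply: leeD.
    rewrite lee_fin powRM ?(ltW l0_gt0) //.
    by rewrite mulrAC.
  rewrite integral_nneseries //.
  apply: lime_le; first by apply: is_cvg_nneseries => k _ _; exact: integral_ge0.
  apply: nearW => N.
  have term k : (\int[leb R n]_(x in cset Q0) ((c k)%:E * (\1_(E k) x)%:E) <=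
      (4 `^ q * weak_const n r * vol Q0 * l0 `^ q * decay ^+ k)%:E)%E.
    have [mE EQ muE _] := Ek k.
    rewrite ge0_integralZl //; last 2 first.
    - exact/measurable_EFinP/measurable_indic.
    - by rewrite lee_fin.
    rewrite integral_indic // (setIidl EQ).
    apply: le_trans (lee_pmul _ _ (lexx _) muE) _ => //; first by rewrite lee_fin.
    rewrite -EFinM lee_fin /c powRM ?mulr_ge0 ?exprn_ge0 ?(ltW l0_gt0) //.
    rewrite powRM ?exprn_ge0 ?(ltW l0_gt0) //.
    have -> : (2 ^+ k) `^ q = (2 `^ q) ^+ k :> R.
      by rewrite -powR_mulrn // -powRrM mulrC powRrM powR_mulrn ?powR_ge0.
    rewrite /decay exprMn le_eqVlt; apply/orP; left; apply/eqP; ring.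
  apply: le_trans (lee_sum _ (fun k _ => term k)) _.
  rewrite sumEFin lee_fin -mulr_sumr.
  have W0 : 0 <= weak_const n r.
    rewrite addr_ge0 // !mulr_ge0 ?invr_ge0 ?powR_ge0 ?exprn_ge0 //.
  have -> : 4 `^ q * weak_const n r / (1 - decay) * vol Q0 * l0 `^ q =
    4 `^ q * weak_const n r * vol Q0 * l0 `^ q * (1 - decay)^-1 by ring.
  apply: ler_wpM2l; last exact: geometric_sum_le decay_lt1.
  by rewrite !mulr_ge0 ?powR_ge0 ?(ltW (vol_gt0 _)).
Qed.

End averages.

(** * Inequalities for powers and for lower integrals *)

Lemma le_poweR (R : realType) (s : R) (x y : \bar R) :
  (0 <= s)%R -> 0 <= x -> x <= y -> x `^ s <= y `^ s.
Proof.
move=> s0 x0 xy; apply: gt0_ler_poweR => //; rewrite in_itv /= leey andbT //.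
exact: le_trans xy.
Qed.

(** The crude bound x + y <= 2 max(x, y) covers both exponents in use, s = q and s = q^-1, as well
    as infinite values; it stands in for Minkowski at the cost of a constant. *)
Lemma poweR_quasi_triangle (R : realType) (s : R) (x y z : \bar R) :
  (0 <= s)%R -> 0 <= x -> 0 <= y -> 0 <= z -> z <= x + y ->
  z `^ s <= (2 `^ s)%:E * (x `^ s + y `^ s).
Proof.
move=> s0 x0 y0 z0 zxy.
have m0 : 0 <= maxe x y by rewrite le_max x0.
have zm : z <= 2%:E * maxe x y.
  apply: le_trans zxy _; rewrite -[2%:E]/((1 + 1)%:E) EFinD ge0_muleDl // !mul1e.
  by apply: leeD; rewrite le_max lexx ?orbT.
apply: le_trans (le_poweR s0 z0 zm) _; rewrite poweRM // poweR_EFin.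
apply: lee_wpmul2l; first by rewrite lee_fin powR_ge0.
by case: (leP x y) => _; [rewrite leeDr|rewrite leeDl] => //; exact: poweR_ge0.
Qed.

(** If v > t, then (v / t)^(q - 1) >= 1. Integrated with t equal to the q-mean of v, this is the
    power-mean inequality up to a factor 2. *)
Lemma le_add_powR (R : realType) (q v t : R) :
  (1 <= q -> 0 <= v -> 0 < t -> v <= t + t `^ (1 - q) * v `^ q)%R.
Proof.
move=> q1 v0 t0; have [vt|tv] := leP v t.
  by rewrite (le_trans vt) // lerDl mulr_ge0 // powR_ge0.
have v1 := lt_trans t0 tv.
apply: le_trans (_ : t `^ (1 - q) * v `^ q <= _)%R; last by rewrite lerDr ltW.
rewrite -{1}(powRr1 v0) -{1}(subrK q 1%R) powRD; last first.
  by rewrite (gt_eqF v1) implybT.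
rewrite ler_pM2r ?powR_gt0 //.
rewrite -[(1 - q)%R]opprB !powRN lef_pV2 ?posrE ?powR_gt0 //.
by rewrite ge0_ler_powR ?nnegrE ?subr_ge0 // ltW.
Qed.

Import HBNNSimple.

(* The lower integral is subadditive as soon as one summand is measurable; this
   is what allows maximal functions of unknown measurability. *)
Lemma ge0_integral_le_add d (T : measurableType d) (R : realType)
    (mu : {measure set T -> \bar R}) (D : set T) (A B H : T -> \bar R) (c : R) :
  (0 < c)%R -> measurable D -> measurable_fun D H ->
  (forall x, 0 <= A x) -> (forall x, 0 <= B x) -> (forall x, 0 <= H x) ->
  (forall x, D x -> A x <= c%:E * (B x + H x)) ->
  \int[mu]_(x in D) A x <=
    c%:E * (\int[mu]_(x in D) B x + \int[mu]_(x in D) H x).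
Proof.
move=> c0 mD mH A0 B0 H0 AB; rewrite [leLHS]ge0_integralE //.
apply: ub_ereal_sup => _ [s sA <-].
have s0 x : (0 <= s x)%R by [].
have -> : sintegral mu s = \int[mu]_(x in D) (s x)%:E.
  rewrite integral_mkcond -integralT_nnsfun; apply: eq_integral => x _.
  rewrite /patch; case: ifPn => // xD; have := sA x.
  by rewrite /patch (negbTE xD) => sx; apply/eqP; rewrite eq_le sx lee_fin s0.
(* The positive part of s / c - H is measurable, lies below B on D and satisfies s <= c (u + H), so
   additivity is needed only for the measurable pair u, H. *)
pose u x : \bar R := maxe 0 ((c^-1 * s x)%:E - H x).
have u0 x : 0 <= u x by rewrite /u le_max lexx.
have mu_ : measurable_fun D u.
  apply: measurable_maxe => //; apply: emeasurable_funB => //.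
  apply/measurable_EFinP/measurable_funM => //.
  by apply: measurable_funTS; exact: measurable_funP.
have cK (y : \bar R) : c%:E * (c^-1%:E * y) = y.
  by rewrite muleA -EFinM mulfV ?mul1e // gt_eqF.
have uB x : D x -> u x <= B x.
  move=> Dx; rewrite /u ge_max B0 /=.
  have := sA x; rewrite /patch mem_set // => sAx.
  have {sAx} := le_trans sAx (AB _ Dx).
  rewrite EFinM; move: (H0 x) (B0 x); case: (H x) => [hx| |] // hx0.
    case: (B x) => [bx| |] //= bx0; rewrite ?leey // -!EFinD -EFinM !lee_fin => h.
    by rewrite lerBlDr mulrC ler_pdivrMr // mulrC.
  by rewrite addeNy // leNye.
have su x : D x -> (s x)%:E <= c%:E * (u x + H x).
  move=> Dx; suff /(lee_wpmul2l (_ : 0 <= c%:E)) : (c^-1 * s x)%:E <= u x + H x.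
    by rewrite EFinM cK; apply; rewrite lee_fin ltW.
  rewrite /u; move: (H0 x); case: (H x) => [hx| |] //= hx0; last first.
    by rewrite addey ?leey // -ltNye; apply: lt_le_trans (u0 x); rewrite ?ltNye.
  by rewrite -leeBlDr // le_max lexx orbT.
apply: le_trans (@ge0_le_integral_nomeas _ _ _ mu D _
  (fun x => c%:E * (u x + H x)) _ su) _.
  by move=> x _; rewrite lee_fin.
rewrite ge0_integralZl //; last 3 first.
- exact: emeasurable_funD.
- by move=> x _; rewrite adde_ge0.
- by rewrite lee_fin ltW.
apply: lee_wpmul2l; first by rewrite lee_fin ltW.
rewrite ge0_integralD //; apply: leeD => //.
exact: ge0_le_integral_nomeas.
Qed.

(** * Comparison of the two references on one cube *)

Section one_cube.
Context (R : realType) (n : nat) (n_gt0 : (0 < n)%N) (f : 'rV[R]_n -> R).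
Context (q : R) (q_ge1 : (1 <= q)%R).
Implicit Types (P Q : cube R n) (h : set 'rV[R]_n -> 'rV[R]_n -> \bar R).

Let q_gt0 : (0 < q)%R. Proof. exact: lt_le_trans ltr01 q_ge1. Qed.

Definition reference h := h = (fun A _ => average A (fun y => `|f y|%:E)) \/
  h = (fun A => maximal A f).

Lemma averageE P (g : 'rV[R]_n -> \bar R) : average (cset P) g =
  (vol P)^-1%:E * \int[leb R n]_(x in cset P) g x.
Proof. by rewrite /average leb_cset. Qed.

Lemma average_ge0 P (g : 'rV[R]_n -> \bar R) : (forall x, 0 <= g x) ->
  0 <= average (cset P) g.
Proof.
move=> g0; rewrite averageE mule_ge0 ?lee_fin ?invr_ge0 ?(ltW (vol_gt0 _)) //.
exact: integral_ge0.
Qed.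

Lemma power_mean P (v : Rn R n -> R) :
  measurable_fun (cset P : set (Rn R n)) v -> (forall x, 0 <= v x)%R ->
  average (cset P) (EFin \o v) <=
  2%:E * average (cset P) (fun x => (v x `^ q)%:E) `^ q^-1.
Proof.
move=> mv v0.
have V0 : (0 < (vol P)^-1)%R by rewrite invr_gt0 vol_gt0.
have mD := measurable_cset P.
have mvq : measurable_fun (cset P : set (Rn R n)) (fun x => (v x `^ q)%:E).
  apply/measurable_EFinP.
  exact: (measurableT_comp (measurable_powR q)).
have vq0 x : 0 <= (v x `^ q)%:E by rewrite lee_fin powR_ge0.
have := average_ge0 P vq0.
case avE : (average _ _) => [m| |] // m0; last first.
  by rewrite poweRyr ?invr_neq0 ?gt_eqF // mulry gtr0_sg // mul1e leey.
rewrite lee_fin in m0; rewrite poweR_EFin -EFinM.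
apply/lee_addgt0Pr => e e0.
(* The q-mean itself may vanish, whereas [le_add_powR] needs t > 0; the excess e / 2 is absorbed by
   the arbitrary e. *)
pose t : R := (m `^ q^-1 + e / 2)%R.
have t0 : (0 < t)%R by rewrite ltr_wpDl ?powR_ge0 ?divr_gt0.
have mt : (m <= t `^ q)%R.
  rewrite -[leLHS](powRr1 m0) -(mulVf (lt0r_neq0 q_gt0)) powRrM.
  by rewrite ge0_ler_powR ?nnegrE ?powR_ge0 ?(ltW q_gt0) ?(ltW t0) // lerDl divr_ge0 // ltW.
have -> : (2 * m `^ q^-1)%:E + e%:E = (2 * t)%:E.
  by rewrite -EFinD; congr EFin; rewrite /t; field.
rewrite averageE.
apply: le_trans (_ : (vol P)^-1%:E * \int[leb R n]_(x in cset P)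
    (t%:E + (t `^ (1 - q))%:E * (v x `^ q)%:E) <= _).
  apply: lee_wpmul2l; first by rewrite lee_fin ltW.
  apply: ge0_le_integral_nomeas => x _ /=; first by rewrite lee_fin.
  by rewrite -EFinM -EFinD lee_fin; exact: le_add_powR.
rewrite ge0_integralD //; last 3 first.
- by move=> x _; rewrite lee_fin ltW.
- by move=> x _; rewrite mule_ge0 // lee_fin powR_ge0.
- by apply: emeasurable_funM => //; exact: measurable_cst.
rewrite ge0_integralZl //; last by rewrite lee_fin powR_ge0.
rewrite ge0_muleDr; last 2 first.
- by apply: integral_ge0 => x _; rewrite lee_fin ltW.
- by rewrite mule_ge0 ?lee_fin ?powR_ge0 //; apply: integral_ge0.
rewrite integral_cst // leb_cset -EFinM mulrCA mulVf ?gt_eqF ?vol_gt0 // mulr1.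
rewrite muleCA -averageE avE -EFinM -EFinD lee_fin.
rewrite mulr_natl mulr2n lerD2l.
apply: le_trans (ler_wpM2l (powR_ge0 _ _) mt) _.
rewrite -powRD; last by rewrite (gt_eqF t0) implybT.
by rewrite subrK powRr1 // ltW.
Qed.

Section fixed_cube.
Variable Q : cube R n.
Hypothesis fint : (leb R n).-integrable (cset Q) (EFin \o f).

Let mf : measurable_fun (cset Q : set (Rn R n)) f.
Proof. by apply/measurable_EFinP; exact: measurable_int fint. Qed.

Let mnf : measurable_fun (cset Q : set (Rn R n)) (fun x : Rn R n => `|f x|%R).
Proof. exact: measurableT_comp. Qed.

(* The positive and the negative part of |f| - |f|_Q have the same integral. *)
Lemma average_neg_part : (osc (cavg f) (cdev f) Q)%:E =
  2%:E * average (cset Q) (fun x => (Num.max 0 (cavg f Q - `|f x|))%:E).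
Proof.
have mQ := measurable_cset Q.
have V0 : vol Q != 0%R by rewrite gt_eqF // vol_gt0.
pose g (x : Rn R n) : R := (`|f x| - cavg f Q)%R.
have gi : (leb R n).-integrable (cset Q) (EFin \o g).
  exact: (integrable_norm_sub fint (cavg f Q) (@subset_refl _ _)).
have ngi := integrable_norm gi.
have g0 : (\int[leb R n]_(x in cset Q) g x = 0)%R.
  rewrite /g RintegralB //; first last.
  - exact: integrable_cst_cube.
  - exact: integrable_norm fint.
  rewrite Rintegral_cst // leb_cset /= /cavg mulrAC mulVf // mul1r.
  by rewrite subrr.
have nE x : (2 * Num.max 0 (cavg f Q - `|f x|) = `|g x| - g x)%R.
  rewrite /g; case: (leP 0%R (cavg f Q - `|f x|)%R) => h.
    by rewrite [`| _ - _|%R]ler0_norm; lra.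
  by rewrite [`| _ - _|%R]ger0_norm; lra.
have mneg : measurable_fun (cset Q : set (Rn R n))
    (fun x => (Num.max 0 (cavg f Q - `|f x|))%:E).
  apply/measurable_EFinP; apply: measurable_maxr; first exact: measurable_cst.
  by apply: measurable_funB => //; exact: measurable_cst.
rewrite averageE muleCA -ge0_integralZl //; last first.
  by move=> x _; rewrite lee_fin le_max lexx.
under eq_integral do rewrite -EFinM nE.
have -> : \int[leb R n]_(x in cset Q) (`|g x| - g x)%:E =
    (\int[leb R n]_(x in cset Q) (`|g x| - g x))%:E.
  rewrite /Rintegral fineK //; apply: integrable_fin_num => //.
  exact: (integrableB mQ ngi gi).
rewrite RintegralB // g0 subr0 -EFinM /osc /cdev mulrC.
by congr EFin.
Qed.

(** [power_mean] wants a measurable function, so it is applied to a measurable minorant v of |f - h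
    Q|. In the constant 4, one factor 2 comes from passing to the negative part, the other from
    [power_mean]. *)
Lemma osc_le_reference h : reference h ->
  (osc (cavg f) (cdev f) Q)%:E <=
  4%:E * average (cset Q) (fun x => `|(f x)%:E - h (cset Q) x| `^ q) `^ q^-1.
Proof.
move=> hE.
have [v [mv v0 vh oscv]] : exists v : Rn R n -> R,
    [/\ measurable_fun (cset Q : set (Rn R n)) v, (forall x, 0 <= v x)%R,
        (forall x, cset Q x -> (v x)%:E <= `|(f x)%:E - h (cset Q) x|) &
        (osc (cavg f) (cdev f) Q)%:E <= 2%:E * average (cset Q) (EFin \o v)].
  case: hE => ->.
    exists (fun x => `| `|f x| - cavg f Q|)%R; split.
    - by apply: measurableT_comp; [|exact: measurable_funB].
    - by [].
    - move=> x Qx; rewrite (average_cavg fint) // -EFinB abse_EFin lee_fin.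
      by rewrite -{1}(ger0_norm (cavg_ge0 f Q)) ler_dist_dist.
    - rewrite averageE -(cdevE fint) // -!EFinM lee_fin /osc mulrC.
      rewrite ler_peMl ?ler1n // mulr_ge0 ?cdev_ge0 // invr_ge0 ltW //.
      exact: vol_gt0.
  exists (fun x => Num.max 0 (cavg f Q - `|f x|))%R; split.
  - by apply: measurable_maxr => //; exact: measurable_funB.
  - by move=> x; rewrite le_max lexx.
  - move=> x Qx; have := cavg_le_maximal fint Qx.
    case: (maximal _ _ _) => [m| |] //=; rewrite ?leey // !lee_fin => cm.
    rewrite ge_max normr_ge0 /= distrC.
    apply: le_trans (ler_norm _); apply: lerB => //; exact: ler_norm.
  - by rewrite average_neg_part.
apply: le_trans oscv _; rewrite (_ : 4 = 2 * 2)%R; last by ring.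
rewrite EFinM -muleA lee_pmul2l //; apply: le_trans (power_mean mv v0) _.
rewrite lee_pmul2l //; apply: le_poweR; first by rewrite invr_ge0 ltW.
  by apply: average_ge0 => x; rewrite lee_fin powR_ge0.
rewrite !averageE lee_pmul2l ?lte_fin ?invr_gt0 ?vol_gt0 //.
apply: ge0_le_integral_nomeas => x Qx; rewrite ?lee_fin ?powR_ge0 //.
by rewrite -poweR_EFin; apply: le_poweR; rewrite ?lee_fin ?(ltW q_gt0) //; exact: vh.
Qed.

Lemma reference_triangle h1 h2 x : reference h1 -> reference h2 -> cset Q x ->
  `|(f x)%:E - h2 (cset Q) x| <=
  `|(f x)%:E - h1 (cset Q) x| + `|maximal (cset Q) f x - (cavg f Q)%:E|.
Proof.
move=> h1E h2E Qx; have := cavg_le_maximal fint Qx.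
case: h1E h2E => -> [] -> //; rewrite ?(average_cavg fint) // ?leeDl //.
  case: (maximal _ _ _) => [m| |] //= _; rewrite ?leey // lee_fin.
  have -> : (f x - m = (f x - cavg f Q) - (m - cavg f Q))%R by ring.
  exact: ler_normB.
case: (maximal _ _ _) => [m| |] //= _; rewrite ?leey // lee_fin.
have -> : (f x - cavg f Q = (f x - m) + (m - cavg f Q))%R by ring.
exact: ler_normD.
Qed.

Context (r : R) (qr : (q < r)%R).

(** The q-th root of 2^q (a + b), with b = [maximal_const] l0^q, is at most 2 * 2^(1/q) (a^(1/q) +
    b^(1/q)); the last factor dominates both resulting coefficients. *)
Definition transfer_const : R :=
  (2 * 2 `^ q^-1 * (1 + maximal_const n q r `^ q^-1))%R.

Lemma weighted_osc_transfer h1 h2 (alpha : R) (kappa : cube R n -> R) (l0 : R) :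
  reference h1 -> reference h2 ->
  (forall P, 0 <= kappa P)%R -> superadditive Q kappa ->
  (forall P, cset P `<=` cset Q ->
     vol P * osc (cavg f) (cdev f) P `^ r <= kappa P)%R ->
  (0 < l0)%R -> (kappa Q <= l0 `^ r * vol Q)%R ->
  weighted_osc q alpha (cset Q) f (h2 (cset Q)) <=
  transfer_const%:E * (weighted_osc q alpha (cset Q) f (h1 (cset Q)) +
    (vol Q `^ (- alpha) * l0)%:E).
Proof.
move=> h1E h2E k0 kS kO l0_gt0 kQ.
have [H [mH H0 MH intH]] := maximal_majorant fint q_ge1 qr n_gt0 k0 kS kO l0_gt0 kQ.
have V0 : (0 < (vol Q)^-1)%R by rewrite invr_gt0 vol_gt0.
have mc0 : (0 <= maximal_const n q r)%R.
  have : 0 <= (maximal_const n q r * vol Q * l0 `^ q)%:E.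
    by apply: le_trans intH; exact: integral_ge0.
  by rewrite lee_fin pmulr_lge0 ?powR_gt0 // pmulr_lge0 // vol_gt0.
set a := average (cset Q) (fun x => `|(f x)%:E - h1 (cset Q) x| `^ q).
have a0 : 0 <= a by apply: average_ge0 => x; exact: poweR_ge0.
have avle : average (cset Q) (fun x => `|(f x)%:E - h2 (cset Q) x| `^ q) <=
    (2 `^ q)%:E * (a + (maximal_const n q r * l0 `^ q)%:E).
  rewrite averageE.
  apply: le_trans (_ : (vol Q)^-1%:E * ((2 `^ q)%:E *
    (\int[leb R n]_(x in cset Q) `|(f x)%:E - h1 (cset Q) x| `^ q +
     \int[leb R n]_(x in cset Q) H x)) <= _).
    rewrite lee_pmul2l //; apply: ge0_integral_le_add => //.
    - exact: measurable_cset.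
    - by move=> x; exact: poweR_ge0.
    - by move=> x; exact: poweR_ge0.
    - move=> x Qx; apply: le_trans (poweR_quasi_triangle (ltW q_gt0) _ _ _
        (reference_triangle h1E h2E Qx)) _ => //.
      apply: lee_wpmul2l; rewrite ?lee_fin ?powR_ge0 //.
      by apply: leeD => //; exact: MH.
  rewrite muleCA lee_pmul2l ?lte_fin ?powR_gt0 // ge0_muleDr; last 2 first.
  - by apply: integral_ge0 => x _; exact: poweR_ge0.
  - exact: integral_ge0.
  rewrite -averageE -/a; apply: leeD => //.
  apply: le_trans (lee_pmul _ _ (lexx _) intH) _.
  - by rewrite lee_fin ltW.
  - exact: integral_ge0.
  by rewrite -EFinM lee_fin mulrAC mulrCA mulVf ?mulr1 // gt_eqF // vol_gt0.
have qV : (0 <= q^-1)%R by rewrite invr_ge0 ltW.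
have b0 : 0 <= (maximal_const n q r * l0 `^ q)%:E.
  by rewrite lee_fin mulr_ge0 // powR_ge0.
have rootle : average (cset Q) (fun x => `|(f x)%:E - h2 (cset Q) x| `^ q) `^ q^-1
    <= transfer_const%:E * (a `^ q^-1 + l0%:E).
  apply: le_trans (le_poweR qV _ avle) _.
    by apply: average_ge0 => x; exact: poweR_ge0.
  rewrite poweRM ?lee_fin ?powR_ge0 ?adde_ge0 // poweR_EFin -powRrM.
  rewrite mulfV ?gt_eqF // powRr1 //.
  apply: le_trans (lee_pmul _ (poweR_ge0 _ _) (lexx _)
    (poweR_quasi_triangle qV a0 b0 (adde_ge0 a0 b0) (lexx _))) _ => //.
  rewrite poweR_EFin powRM ?powR_ge0 // -powRrM mulfV ?gt_eqF // powRr1 ?(ltW l0_gt0) //.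
  rewrite [leLHS]muleA -[X in X * _ <= _]EFinM /transfer_const.
  rewrite [X in _ <= X * _]EFinM -[leRHS]muleA.
  rewrite lee_pmul2l ?lte_fin ?mulr_gt0 ?powR_gt0 //.
  rewrite ge0_muleDr ?poweR_ge0 ?lee_fin ?(ltW l0_gt0) //.
  apply: leeD.
    by apply: lee_pemull; rewrite ?poweR_ge0 // lee_fin lerDl powR_ge0.
  by rewrite -EFinM lee_fin ler_wpM2r ?(ltW l0_gt0) // lerDr.
rewrite /weighted_osc leb_cset /= -/a.
apply: le_trans (lee_pmul _ (poweR_ge0 _ _) (lexx _) rootle) _.
  by rewrite lee_fin powR_ge0.
by rewrite muleCA ge0_muleDr ?poweR_ge0 ?lee_fin ?(ltW l0_gt0) // EFinM.
Qed.

End fixed_cube.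

End one_cube.

(** * Suprema over packings *)

Section packing_sup.
Context (R : realType) (n : nat) (F : set 'rV[R]_n -> \bar R).
Hypothesis F0 : forall A, 0 <= F A.
Implicit Types (A B X : set 'rV[R]_n) (C D E : set (set 'rV[R]_n)).

Definition packing_sup X : \bar R :=
  ereal_sup [set \esum_(A in C) F A | C in packing X].

Lemma packing0 X : packing X set0.
Proof. by split => // A B []. Qed.

Lemma packing_sup_ge0 X : 0 <= packing_sup X.
Proof.
apply: ereal_sup_ubound; exists set0; first exact: packing0.
by rewrite esum_set0.
Qed.

Lemma packing_sub A X C : A `<=` X -> packing A C -> packing X C.
Proof. by move=> AX [h1 h2 h3]; split => // B /h2 BA; exact: subset_trans BA AX. Qed.

Lemma packing_sup_mono A X : A `<=` X -> packing_sup A <= packing_sup X.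
Proof.
move=> AX; apply: ereal_sup_le => _ [C AC <-]; exists C => //.
exact: packing_sub AC.
Qed.

Lemma le_packing_sup A X : is_cube A -> A `<=` X -> F A <= packing_sup X.
Proof.
move=> cA AX; apply: ereal_sup_ubound; exists [set A]; last by rewrite esum_set1.
by split => [B ->|B ->|B B' -> ->].
Qed.

Lemma ereal_supD_le (S : set (\bar R)) (c M : \bar R) : S !=set0 -> 0 <= c ->
  (forall y, S y -> 0 <= y) -> (forall y, S y -> y + c <= M) ->
  ereal_sup S + c <= M.
Proof.
move=> [y0 Sy0] c0 S0 SM; case: c c0 SM => [c| |] // c0 SM.
  by rewrite -leeBrDr //; apply: ge_ereal_sup => y /SM; rewrite -leeBrDr.
have := SM _ Sy0; rewrite addey; last first.
  by rewrite -ltNye; apply: lt_le_trans (S0 _ Sy0); exact: ltNy0.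
by rewrite leye_eq => /eqP ->; exact: leey.
Qed.

Lemma interior_cube_neq0 A : is_cube A -> interior A !=set0.
Proof.
by move=> /is_cubeP[Q ->]; exists (center Q); exact: interior_cset_center.
Qed.

(** The accumulator E drives the induction: the supremum over the first cube is tested on one of its
    packings D, and the union of D and E replaces E for the remaining cubes. D and E share no member
    because cubes have nonempty interior, so the two sums merge exactly. *)
Lemma sum_packing_supD X (s : seq (set 'rV[R]_n)) E : uniq s ->
  packing X [set` s] -> packing X E ->
  (forall A B, A \in s -> E B -> interior A `&` interior B = set0) ->
  \sum_(A <- s) packing_sup A + \esum_(A in E) F A <= packing_sup X.
Proof.
elim: s E => [|A s IH] E.
  move=> _ _ XE _; rewrite big_nil add0e.
  by apply: ereal_sup_ubound; exists E.
rewrite cons_uniq => /andP[As us] [cs sX ts] XE sE.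
rewrite big_cons -addeA; apply: ereal_supD_le.
- by exists 0; exists set0; [exact: packing0|rewrite esum_set0].
- rewrite adde_ge0 //; first by apply: sume_ge0 => B _; exact: packing_sup_ge0.
  by apply: esum_ge0 => B _.
- by move=> _ [D _ <-]; apply: esum_ge0 => B _.
move=> _ [D AD <-].
have AX : A `<=` X by apply: sX => /=; rewrite mem_head.
have XD := packing_sub AX AD.
have intDA B : D B -> interior B `<=` interior A.
  by case: AD => _ h _ /h; exact: interiorS.
have DE B : D B -> ~ E B.
  move=> DB EB; have [x xB] : interior B !=set0.
    by apply: interior_cube_neq0; case: XD => h _ _; exact: h.
  have := sE A B (mem_head _ _) EB.
  by apply/eqP/set0P; exists x; split => //; exact: (intDA _ DB).
rewrite addeCA.
have -> : \esum_(B in D) F B + \esum_(B in E) F B = \esum_(B in D `|` E) F B.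
  rewrite [RHS](esumID D); last by move=> B _.
  congr adde.
    congr esum; apply/seteqP; split => [B DB|B [] //].
    by split => //; left.
  congr esum; apply/seteqP; split => [B EB|B [[]//]].
  by split; [right|move=> /DE].
apply: IH => //.
- split=> [B Bs|B Bs|B B' Bs Bs'].
  + by apply: cs => /=; rewrite inE; apply/orP; right.
  + by apply: sX => /=; rewrite inE; apply/orP; right.
  + by apply: ts => /=; rewrite inE; apply/orP; right.
- case: XD XE => [cD DX tD] [cE EX tE]; split.
  + by move=> B [/cD|/cE].
  + by move=> B [/DX|/EX].
  + move=> B B' [DB|EB] [DB'|EB'] [x [xB xB']].
    * by apply: tD => //; exists x.
    * have := sE A B' (mem_head _ _) EB'; move=> /seteqP[/(_ x) h _].
      by case: h; split => //; exact: intDA xB.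
    * have := sE A B (mem_head _ _) EB; move=> /seteqP[/(_ x) h _].
      by case: h; split => //; exact: intDA xB'.
    * by apply: tE => //; exists x.
- move=> A' B A's [DB|EB]; last first.
    by apply: sE => //; rewrite inE; apply/orP; right.
  apply/eqP/negPn/negP => /set0P[x [xA' xB]].
  suff AA' : A' = A by move: As; rewrite -AA' A's.
  apply: ts; rewrite /= ?inE ?eqxx ?A's ?orbT //.
  by exists x; split => //; exact: intDA xB.
Qed.

Lemma sum_packing_sup X (s : seq (set 'rV[R]_n)) : uniq s ->
  packing X [set` s] -> \sum_(A <- s) packing_sup A <= packing_sup X.
Proof.
move=> us Xs; have := sum_packing_supD us Xs (packing0 X).
by rewrite esum_set0 adde0; apply.
Qed.

Lemma esum_le_packing_sup X C (G : set 'rV[R]_n -> \bar R) (c : R) :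
  (0 <= c)%R -> packing X C ->
  (forall A, C A -> G A <= c%:E * packing_sup A) ->
  \esum_(A in C) G A <= c%:E * packing_sup X.
Proof.
move=> c0 [cC CX tC] GC; apply: ge_ereal_sup => _ [D [finD DC] <-].
rewrite fsbig_finite //=.
have Ds A : A \in finmap.enum_fset (fset_set D) -> D A.
  by rewrite in_fset_set // inE.
apply: le_trans (_ : \sum_(A <- finmap.enum_fset (fset_set D))
    c%:E * packing_sup A <= _).
  rewrite big_seq [leRHS]big_seq; apply: lee_sum => A /Ds /DC; exact: GC.
rewrite -ge0_sume_distrr; last by move=> A _; exact: packing_sup_ge0.
apply: lee_wpmul2l; first by rewrite lee_fin.
apply: sum_packing_sup; first exact: finmap.fset_uniq.
by split=> [A /Ds/DC/cC|A /Ds/DC/CX|A B /Ds/DC CA /Ds/DC CB]//; exact: tC.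
Qed.

End packing_sup.

(** * From the weak-type estimate to the weighted seminorms *)

Section main_estimate.
Context (R : realType) (n : nat) (n_gt0 : (0 < n)%N) (f : 'rV[R]_n -> R).
Context (q r alpha : R) (q_ge1 : (1 <= q)%R) (qr : (q < r)%R).
Hypothesis alpha_ge0 : (0 <= alpha)%R.
Implicit Types (P Q : cube R n) (h : set 'rV[R]_n -> 'rV[R]_n -> \bar R).

Let q_gt0 : (0 < q)%R. Proof. exact: lt_le_trans ltr01 q_ge1. Qed.

Let r_gt0 : (0 < r)%R. Proof. exact: lt_trans q_gt0 qr. Qed.

Lemma weighted_osc_ge0 A (g : 'rV[R]_n -> \bar R) :
  0 <= weighted_osc q alpha A f g.
Proof. by rewrite mule_ge0 ?poweR_ge0 // lee_fin powR_ge0. Qed.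

Lemma transfer_const_gt0 : (0 < transfer_const n q r)%R.
Proof.
rewrite /transfer_const mulr_gt0 ?mulr_gt0 ?powR_gt0 //.
by rewrite ltr_wpDr ?powR_ge0.
Qed.

Section in_cube.
Variable Q : cube R n.
Hypothesis fint : (leb R n).-integrable (cset Q) (EFin \o f).

(** The weight of P is removed by |P|^alpha <= |Q|^alpha, at the price of a factor that depends on Q
    alone and later cancels against the weight of Q in [weighted_osc_transfer]. *)
Lemma osc_le_weighted_osc h P : reference f h -> cset P `<=` cset Q ->
  (osc (cavg f) (cdev f) P)%:E <=
  (4 * vol Q `^ alpha)%:E * weighted_osc q alpha (cset P) f (h (cset P)).
Proof.
move=> hE PQ.
apply: le_trans (osc_le_reference q_ge1 (integrable_sub_cube fint PQ) hE) _.
rewrite /weighted_osc leb_cset /= [leRHS]muleA -[X in _ <= X * _]EFinM.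
apply: lee_pmul; rewrite ?lee_fin ?poweR_ge0 //.
rewrite -mulrA ler_peMr // powRN.
rewrite -ler_pdivrMr ?invr_gt0 ?powR_gt0 ?vol_gt0 // invrK mul1r.
rewrite ge0_ler_powR ?nnegrE ?(ltW (vol_gt0 _)) //.
rewrite /vol lerXn2r ?nnegrE ?(ltW (side_gt0 _)) //.
exact: sub_cset_side.
Qed.

Lemma weighted_osc_bound h1 h2 (kappa : cube R n -> R) (m : R) :
  reference f h1 -> reference f h2 ->
  (forall P, 0 <= kappa P)%R -> superadditive Q kappa ->
  (forall P, cset P `<=` cset Q ->
     vol P * osc (cavg f) (cdev f) P `^ r <= kappa P)%R ->
  (0 <= m)%R -> weighted_osc q alpha (cset Q) f (h1 (cset Q)) <= m%:E ->
  (kappa Q <= (4 * vol Q `^ alpha * m) `^ r * vol Q)%R ->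
  weighted_osc q alpha (cset Q) f (h2 (cset Q)) <=
  (5 * transfer_const n q r * m)%:E.
Proof.
move=> h1E h2E k0 kS kO m0 wm kQ.
have K0 := transfer_const_gt0.
have va0 : (0 < vol Q `^ alpha)%R by rewrite powR_gt0 // vol_gt0.
apply/lee_addgt0Pr => e e0.
(* The height l0 must be positive while m may be 0, hence m + d. The final bound is T (m + 4 (m +
   d)) = 5 T m + e with T = [transfer_const n q r], which explains the 5. *)
pose d : R := (e / (4 * transfer_const n q r))%R.
have d0 : (0 < d)%R by rewrite divr_gt0 // mulr_gt0.
have l0_gt0 : (0 < 4 * vol Q `^ alpha * (m + d))%R.
  by rewrite !mulr_gt0 // ltr_wpDl.
have kQ' : (kappa Q <= (4 * vol Q `^ alpha * (m + d)) `^ r * vol Q)%R.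
  apply: le_trans kQ _; rewrite ler_pM2r ?vol_gt0 // ge0_ler_powR ?(ltW r_gt0) //.
  - by rewrite nnegrE !mulr_ge0 // ltW.
  - by rewrite nnegrE ltW.
  - by rewrite ler_pM2l ?mulr_gt0 // lerDl ltW.
apply: le_trans (weighted_osc_transfer n_gt0 q_ge1 fint qr alpha h1E h2E
  k0 kS kO l0_gt0 kQ') _.
apply: le_trans (_ : (transfer_const n q r)%:E * (m%:E + (4 * (m + d))%:E) <= _).
  apply: lee_wpmul2l; first by rewrite lee_fin ltW.
  apply: leeD => //; rewrite lee_fin powRN.
  rewrite le_eqVlt; apply/orP; left; apply/eqP; field.
  by rewrite gt_eqF.
rewrite -EFinD -EFinM -EFinD lee_fin le_eqVlt; apply/orP; left; apply/eqP.
by rewrite /d; field; rewrite gt_eqF.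
Qed.

Lemma superadditive_vol (c : R) : (0 <= c)%R ->
  superadditive Q (fun P => vol P * c)%R.
Proof.
move=> c0 I A P Q' _ PQ' tA.
rewrite -mulr_suml ler_wpM2r // -lee_fin -sumEFin -leb_cset.
under eq_bigr do rewrite -leb_cset.
have mP i : measurable (cset (P i) : set (Rn R n)) by exact: measurable_cset.
have fA : finite_set [set` A] by exact: finite_finset.
have -> : \sum_(i in A) leb R n (cset (P i)) =
    leb R n (\bigcup_(i in [set` A]) cset (P i)).
  rewrite (measure_fin_bigcup (leb R n) fA tA) //.
  have -> : [set` A] = [set` enum A].
    by apply/seteqP; split => i /=; rewrite mem_enum.
  by rewrite -fsbig_seq ?enum_uniq // big_enum.
apply: le_measure; rewrite ?inE.
- exact: fin_bigcup_measurable.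
- exact: measurable_cset.
- by move=> x [i iA]; exact: PQ'.
Qed.

End in_cube.

Definition JN_term h (A : set 'rV[R]_n) : \bar R :=
  leb R n A * weighted_osc q alpha A f (h A) `^ r.

Lemma JN_term_ge0 h A : 0 <= JN_term h A.
Proof. by rewrite mule_ge0 ?poweR_ge0. Qed.

Lemma superadditive_packing_sup h Q (c : R) : (0 <= c)%R ->
  packing_sup (JN_term h) (cset Q) < +oo ->
  superadditive Q (fun P => c * fine (packing_sup (JN_term h) (cset P)))%R.
Proof.
move=> c0 fQ I A P Q' Q'Q PQ' tA.
have T0 := JN_term_ge0 h.
have fin B : B `<=` cset Q -> packing_sup (JN_term h) B \is a fin_num.
  move=> BQ; rewrite ge0_fin_numE ?packing_sup_ge0 //.
  exact: le_lt_trans (packing_sup_mono _ BQ) fQ.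
rewrite -mulr_sumr ler_wpM2l // -lee_fin -sumEFin fineK ?fin //.
rewrite (eq_bigr (fun i => packing_sup (JN_term h) (cset (P i)))); last first.
  by move=> i iA; rewrite fineK // fin //; exact: subset_trans (PQ' _ iA) Q'Q.
have -> : \sum_(i in A) packing_sup (JN_term h) (cset (P i)) =
    \sum_(B <- [seq cset (P i) | i <- enum A]) packing_sup (JN_term h) B.
  by rewrite big_map big_enum.
apply: (sum_packing_sup T0).
  rewrite map_inj_in_uniq ?enum_uniq // => i j; rewrite !mem_enum => iA jA ij.
  apply: tA => //; rewrite ij setIid; exact: cset_neq0.
split=> [B|B|B B'] /=.
- by move=> /mapP[i _ ->]; exact: is_cube_cset.
- by move=> /mapP[i]; rewrite mem_enum => iA ->; exact: PQ'.
- move=> /mapP[i]; rewrite mem_enum => iA -> /mapP[j]; rewrite mem_enum => jA ->.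
  move=> [x [xi xj]]; congr (cset (P _)); apply: tA => //.
  by exists x; split; exact: interior_subset.
Qed.

Lemma JN_term_transfer h1 h2 Q : reference f h1 -> reference f h2 ->
  (leb R n).-integrable (cset Q) (EFin \o f) ->
  packing_sup (JN_term h1) (cset Q) < +oo ->
  JN_term h2 (cset Q) <=
  ((5 * transfer_const n q r) `^ r)%:E * packing_sup (JN_term h1) (cset Q).
Proof.
move=> h1E h2E fint foo.
have T0 := JN_term_ge0 h1.
have V0 := vol_gt0 Q.
set k : R := fine (packing_sup (JN_term h1) (cset Q)).
have k0 : (0 <= k)%R by apply: fine_ge0; exact: packing_sup_ge0.
have kE : packing_sup (JN_term h1) (cset Q) = k%:E.
  by rewrite fineK // ge0_fin_numE ?packing_sup_ge0.
(* Chosen so that |Q| m^r is the packing supremum k over Q. The packing formed by Q alone gives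
   [weighted_osc] at most m, and the condition on [kappa Q] then holds with equality. *)
pose m : R := ((k / vol Q) `^ r^-1)%R.
have kV0 : (0 <= k / vol Q)%R by rewrite divr_ge0 // ltW.
have mr : (m `^ r = k / vol Q)%R.
  by rewrite /m -powRrM mulVf ?(lt0r_neq0 r_gt0) // powRr1.
have m0 : (0 <= m)%R by exact: powR_ge0.
have wm : weighted_osc q alpha (cset Q) f (h1 (cset Q)) <= m%:E.
  have : JN_term h1 (cset Q) <= k%:E.
    by rewrite -kE; apply: le_packing_sup => //; exact: is_cube_cset.
  rewrite /JN_term leb_cset => h.
  have {}h : weighted_osc q alpha (cset Q) f (h1 (cset Q)) `^ r <= (k / vol Q)%:E.
    have := lee_wpmul2l (_ : 0 <= (vol Q)^-1%:E) h.
    rewrite muleA -EFinM mulVf ?gt_eqF // mul1e -EFinM mulrC; apply.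
    by rewrite lee_fin invr_ge0 ltW.
  have := le_poweR (_ : (0 <= r^-1)%R) (poweR_ge0 _ _) h.
  rewrite -poweRrM mulfV ?(lt0r_neq0 r_gt0) // poweRe1 ?weighted_osc_ge0 //.
  by rewrite poweR_EFin; apply; rewrite invr_ge0 ltW.
have va0 : (0 <= 4 * vol Q `^ alpha)%R by rewrite mulr_ge0 // powR_ge0.
have := @weighted_osc_bound Q fint h1 h2
  (fun P => (4 * vol Q `^ alpha) `^ r *
     fine (packing_sup (JN_term h1) (cset P)))%R m h1E h2E.
move=> /(_ _ _ _ m0 wm _) wh2.
have {wh2} wh2 : weighted_osc q alpha (cset Q) f (h2 (cset Q)) <=
    (5 * transfer_const n q r * m)%:E.
  apply: wh2.
  - move=> P; rewrite mulr_ge0 ?powR_ge0 // fine_ge0 //; exact: packing_sup_ge0.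
  - by apply: superadditive_packing_sup => //; exact: powR_ge0.
  - move=> P PQ; rewrite -lee_fin [leRHS]EFinM fineK; last first.
      rewrite ge0_fin_numE ?packing_sup_ge0 //.
      exact: le_lt_trans (packing_sup_mono _ PQ) foo.
    apply: le_trans (_ : ((4 * vol Q `^ alpha) `^ r)%:E * JN_term h1 (cset P) <= _);
      last first.
      apply: lee_wpmul2l; first by rewrite lee_fin powR_ge0.
      by apply: le_packing_sup => //; exact: is_cube_cset.
    rewrite /JN_term leb_cset [leRHS]muleCA EFinM.
    apply: lee_wpmul2l; first by rewrite lee_fin ltW // vol_gt0.
    rewrite -!poweR_EFin -poweRM ?weighted_osc_ge0 ?lee_fin //.
    apply: le_poweR; rewrite ?(ltW r_gt0) ?lee_fin ?osc_ge0 //.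
      by move=> *; exact: cdev_ge0.
    exact: osc_le_weighted_osc.
  - rewrite (powRM _ va0 m0) mr -mulrA ler_wpM2l ?powR_ge0 //.
    by rewrite divfK // gt_eqF.
rewrite /JN_term leb_cset kE.
have K0 : (0 <= 5 * transfer_const n q r)%R by rewrite mulr_ge0 // ltW // transfer_const_gt0.
apply: le_trans (_ : (vol Q)%:E * (5 * transfer_const n q r * m)%:E `^ r <= _).
  apply: lee_wpmul2l; first by rewrite lee_fin ltW.
  by apply: le_poweR; rewrite ?(ltW r_gt0) ?weighted_osc_ge0.
rewrite poweR_EFin -!EFinM lee_fin powRM // mr.
rewrite le_eqVlt; apply/orP; left; apply/eqP; field.
by rewrite gt_eqF.
Qed.

End main_estimate.

Lemma bounded_cset (R : realType) (n : nat) (Q : cube R n) :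
  bounded_set (cset Q).
Proof.
exists (\sum_i `|corner Q ord0 i| + side Q)%R; split; first exact: num_real.
move=> N MN x Qx /=; apply: le_trans (ltW MN).
have S0 : (0 <= \sum_i `|corner Q ord0 i|)%R by apply: sumr_ge0.
rewrite /Num.norm /= mx_normrE; apply: bigmax_le => [|[i j] _ /=].
  by rewrite addr_ge0 // ltW // side_gt0.
rewrite (ord1 i) ler_norml; have /andP[h1 h2] := cset_le j Qx.
have Q0 := side_gt0 Q.
have : (`|corner Q ord0 j| <= \sum_i `|corner Q ord0 i|)%R.
  by rewrite (bigD1 j) //= lerDl sumr_ge0.
rewrite ler_norml => /andP[h3 h4]; lra.
Qed.

(** * Transfer between the two seminorms *)

Section theorem.
Context (R : realType) (n : nat) (n_gt0 : (0 < n)%N).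
Context (X : set 'rV[R]_n) (hX : X = setT \/ is_cube X).
Context (q alpha : R) (q_ge1 : (1 <= q)%R) (alpha_ge0 : (0 <= alpha)%R).

Let q_gt0 : (0 < q)%R. Proof. exact: lt_le_trans ltr01 q_ge1. Qed.

Lemma measurable_domain : measurable (X : set (Rn R n)).
Proof.
case: hX => [->|/is_cubeP[Q ->]]; first exact: measurableT.
exact: measurable_cset.
Qed.

Lemma Lq_loc_integrable (f : 'rV[R]_n -> R) (Q : cube R n) :
  Lq_loc q X f -> cset Q `<=` X ->
  (leb R n).-integrable (cset Q) (EFin \o f).
Proof.
move=> [mf fq] QX; have mQ := measurable_cset Q.
have mfQ : measurable_fun (cset Q : set (Rn R n)) f.
  exact: measurable_funS measurable_domain QX mf.
apply/integrableP; split; first exact/measurable_EFinP.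
have mp : measurable_fun (cset Q : set (Rn R n)) (fun x => (`|f x| `^ q)%:E).
  apply/measurable_EFinP; apply: (measurableT_comp (measurable_powR q)).
  exact: measurableT_comp.
have fin : \int[leb R n]_(x in cset Q) (`|f x| `^ q)%:E < +oo.
  apply: le_lt_trans (fq (cset Q) mQ (bounded_cset Q) QX).
  rewrite le_eqVlt; apply/orP; left; apply/eqP.
  rewrite integral_mkcond [RHS]integral_mkcond; apply: eq_integral => x _.
  rewrite /patch; case: ifPn => [xQ|xQ].
    by rewrite mem_set //; apply: QX; rewrite inE in xQ.
  by case: ifP => // _; rewrite normr0 powR0 // gt_eqF.
apply: le_lt_trans (_ : \int[leb R n]_(x in cset Q) (1 + (`|f x| `^ q)%:E) < +oo).
  apply: ge0_le_integral_nomeas => x _ /=; first by [].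
  rewrite -EFinD lee_fin.
  have [h|h] := leP `|f x|%R 1%R; first by rewrite (le_trans h) // lerDl powR_ge0.
  by apply: le_trans (le1r_powR (ltW h) q_ge1) _; rewrite lerDr.
rewrite ge0_integralD // integral_cst // leb_cset mul1e.
by apply: lte_add_pinfty => //; exact: ltry.
Qed.

(** A term of h2 on Q is bounded not by the term of h1 on Q but by the packing supremum of h1 inside
    Q; these suprema add up over a packing of X to at most the one for X. *)
Lemma JN_sup_transfer_fin (r : R) : (q < r)%R ->
  exists2 C : R, (0 < C)%R & forall (f : 'rV[R]_n -> R) h1 h2,
    Lq_loc q X f -> reference f h1 -> reference f h2 ->
    JN_sup r%:E q alpha X f h2 <= C%:E * JN_sup r%:E q alpha X f h1.
Proof.
move=> qr; have r_gt0 : (0 < r)%R by exact: lt_trans qr.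
have K0 : (0 < 5 * transfer_const n q r)%R by rewrite mulr_gt0 ?transfer_const_gt0.
exists (5 * transfer_const n q r)%R => // f h1 h2 fX h1E h2E.
rewrite /JN_sup; set N := ereal_sup [set (\esum_(Q in C) (leb R n Q *
  weighted_osc q alpha Q f (h1 Q) `^ r)) `^ r^-1 | C in packing X].
have rV : (0 <= r^-1)%R by rewrite invr_ge0 ltW.
have T0 h := @JN_term_ge0 R n f q r alpha h.
have N0 : 0 <= N.
  apply: ereal_sup_ubound; exists set0; first exact: packing0.
  by rewrite esum_set0 poweR0r // gt_eqF // invr_gt0.
have [->|Noo] := eqVneq N +oo.
  by rewrite gt0_muley ?lte_fin // leey.
have {}Noo : N < +oo by rewrite lt_neqAle Noo leey.
have XN : packing_sup (JN_term f q r alpha h1) X <= N `^ r.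
  apply: ge_ereal_sup => _ [C XC <-].
  have : (\esum_(A in C) JN_term f q r alpha h1 A) `^ r^-1 <= N.
    by apply: ereal_sup_ubound; exists C.
  move=> /(le_poweR (ltW r_gt0) (poweR_ge0 _ _)).
  rewrite -poweRrM mulVf ?(lt0r_neq0 r_gt0) // poweRe1 //.
  by apply: esum_ge0 => A _.
apply: ge_ereal_sup => _ [C XC <-].
have CN : \esum_(A in C) JN_term f q r alpha h2 A <=
    ((5 * transfer_const n q r) `^ r)%:E * N `^ r.
  apply: le_trans (lee_wpmul2l _ XN); last by rewrite lee_fin powR_ge0.
  apply: esum_le_packing_sup => //; first exact: powR_ge0.
  move=> A CA; have [cC CX _] := XC.
  have [Q AQ] := (is_cubeP A).1 (cC _ CA); have AX := CX _ CA; subst A.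
  apply: JN_term_transfer => //; first exact: Lq_loc_integrable AX.
  apply: le_lt_trans (packing_sup_mono _ AX) _.
  by apply: le_lt_trans XN _; exact: poweR_lty.
apply: le_trans (le_poweR rV _ CN) _; first by apply: esum_ge0 => A _.
rewrite -poweR_EFin -poweRM // ?lee_fin ?(ltW K0) // -poweRrM.
by rewrite mulfV ?(lt0r_neq0 r_gt0) // poweRe1 // mule_ge0 // lee_fin ltW.
Qed.

Lemma JN_sup_transfer_inf : exists2 C : R, (0 < C)%R &
  forall (f : 'rV[R]_n -> R) h1 h2,
    Lq_loc q X f -> reference f h1 -> reference f h2 ->
    JN_sup +oo q alpha X f h2 <= C%:E * JN_sup +oo q alpha X f h1.
Proof.
(* Any exponent above q would do: a uniform bound on the oscillation makes a constant multiple of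
   the volume an admissible [kappa], whatever r is. *)
pose r : R := (q + 1)%R.
have qr : (q < r)%R by rewrite ltrDl.
have r_gt0 : (0 < r)%R by exact: lt_trans qr.
have K0 : (0 < 5 * transfer_const n q r)%R by rewrite mulr_gt0 ?transfer_const_gt0.
exists (5 * transfer_const n q r)%R => // f h1 h2 fX h1E h2E.
rewrite /JN_sup; set N := ereal_sup [set weighted_osc q alpha Q f (h1 Q) |
  Q in [set Q | is_cube Q /\ Q `<=` X]].
apply: ge_ereal_sup => _ [A [/is_cubeP[Q ->] QX] <-].
have Nge (P : cube R n) : cset P `<=` X ->
    weighted_osc q alpha (cset P) f (h1 (cset P)) <= N.
  by move=> PX; apply: ereal_sup_ubound; exists (cset P) => //; split => //;
    exact: is_cube_cset.
have := le_trans (weighted_osc_ge0 _ _ _ _ _) (Nge Q QX).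
case: N Nge => [m| |] // Nge m0; last by rewrite gt0_muley ?lte_fin // leey.
rewrite lee_fin in m0; rewrite -EFinM.
have c0 : (0 <= (4 * vol Q `^ alpha * m) `^ r)%R by exact: powR_ge0.
have fint := Lq_loc_integrable fX QX.
apply: (@weighted_osc_bound R n n_gt0 f q r alpha q_ge1 qr Q fint h1 h2
  (fun P => (vol P * (4 * vol Q `^ alpha * m) `^ r)%R)) => //.
- by move=> P; rewrite mulr_ge0 // ltW // vol_gt0.
- exact: superadditive_vol.
- move=> P PQ; rewrite ler_pM2l ?vol_gt0 // ge0_ler_powR ?(ltW r_gt0) //.
  + by rewrite nnegrE osc_ge0 // => *; exact: cdev_ge0.
  + by rewrite nnegrE !mulr_ge0 ?powR_ge0.
  + rewrite -lee_fin.
    apply: le_trans (osc_le_weighted_osc n_gt0 q_ge1 alpha_ge0 fint h1E PQ) _.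
    rewrite [leRHS]EFinM.
    apply: lee_wpmul2l; first by rewrite lee_fin mulr_ge0 ?powR_ge0.
    exact/Nge/(subset_trans PQ).
- exact: Nge.
- by rewrite mulrC.
Qed.

Lemma JN_sup_transfer (p : \bar R) : q%:E < p ->
  exists2 C : R, (0 < C)%R & forall (f : 'rV[R]_n -> R) h1 h2,
    Lq_loc q X f -> reference f h1 -> reference f h2 ->
    JN_sup p q alpha X f h2 <= C%:E * JN_sup p q alpha X f h1.
Proof.
case: p => [r| |] // qr; last exact: JN_sup_transfer_inf.
by apply: JN_sup_transfer_fin; rewrite lte_fin in qr.
Qed.

End theorem.

Unset Implicit Arguments.

Theorem theorem3p10 (R : realType) (n : nat) (n_gt0 : (0 < n)%N)
    (X : set 'rV[R]_n) (hX : X = setT \/ is_cube X)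
    (q : R) (p : \bar R) (alpha : R)
    (q_ge1 : (1 <= q)%R) (q_lt_p : q%:E < p) (alpha_ge0 : (0 <= alpha)%R) :
  (forall f : 'rV[R]_n -> R,
     JN_space p q alpha X f <->
     Lq_loc q X f /\ A_norm p q alpha X f < +oo) /\
  (exists c1 c2 : R, (0 < c1)%R /\ (0 < c2)%R /\
     forall f : 'rV[R]_n -> R, Lq_loc q X f ->
       c1%:E * A_norm p q alpha X f <= JN_norm p q alpha X f /\
       JN_norm p q alpha X f <= c2%:E * A_norm p q alpha X f).
Proof.
have [C C0 HC] := JN_sup_transfer n_gt0 hX q_ge1 alpha_ge0 q_lt_p.
have AJ f : Lq_loc q X f ->
    A_norm p q alpha X f <= C%:E * JN_norm p q alpha X f.
  by move=> fX; apply: HC => //; [left|right].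
have JA f : Lq_loc q X f ->
    JN_norm p q alpha X f <= C%:E * A_norm p q alpha X f.
  by move=> fX; apply: HC => //; [right|left].
have Coo (y : \bar R) : y < +oo -> C%:E * y < +oo.
  by move=> yoo; rewrite lte_mul_pinfty // ?lee_fin ?ltW.
split=> [f|].
  split=> -[fX foo]; split => //.
    by apply: le_lt_trans (AJ f fX) _; exact: Coo.
  by apply: le_lt_trans (JA f fX) _; exact: Coo.
exists C^-1%R, C; split; first by rewrite invr_gt0.
split=> // f fX; split; last exact: JA.
have := lee_wpmul2l (_ : 0 <= C^-1%:E) (AJ f fX).
rewrite muleA -EFinM mulVf ?gt_eqF // mul1e; apply.
by rewrite lee_fin invr_ge0 ltW.
Qed.
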